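(* Let $\mu$ be a probability measure on a set $\mathcal{X}$ and let $k:\mathcal{X}\times\mathcal{X}\to\mathbb{R}$ be a positive-definite kernel with real RKHS $\mathcal{H}$, such that $\kappa:=\sup_{x\in\mathcal{X}}\sqrt{k(x,x)}<\infty$ and $k$ admits a Mercer expansion $k(x,y)=\sum_{j=1}^\infty \sigma_j e_j(x)e_j(y)$ for all $x,y\in\mathcal{X}$, where $(e_j)_{j\ge1}$ is an orthonormal set in $L^2(\mu)$ and $\sigma_1\ge\sigma_2\ge\cdots\ge0$. Let $N,d$ be positive integers with $6(d+1)\le N$, let $x_1,\dots,x_N\sim\mu$ be independent, and set $n_d:=\lfloor N/(6(d+1))\rfloor$. Let $T\ge0$ be an integer, let $\bm w^{(T)}$ be the output of the Frank--Wolfe procedure (described in the context) after $T$ steps, and define $Q_{N,T}(f):=\sum_{i=1}^N w_i^{(T)}f(x_i)$. Then, with probability at least $1-2^{-(d+1)}$, \[ \operatorname{wce}(Q_{N,T};\mathcal{H},\mu)\le 2\sqrt{\sum_{j>d}\sigma_j}+\frac{4\kappa}{n_d}+\frac{4\kappa}{\sqrt{T+2}}. \]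
   Context: $\Delta_N:=\{\bm w\in\mathbb{R}^N_{\ge0}:\sum_{i=1}^N w_i=1\}$ and $\bm 1_i\in\Delta_N$ denotes the $i$-th unit vector. The kernel mean embedding is $m_\mu:=\int k(x,\cdot)\,\mathrm{d}\mu(x)\in\mathcal{H}$, so $m_\mu(x_i)=\int k(x,x_i)\,\mathrm{d}\mu(x)$. The worst-case error of $Q(f)=\sum_iw_if(x_i)$ is $\operatorname{wce}(Q;\mathcal{H},\mu):=\sup_{\|f\|_{\mathcal{H}}\le1}|\int f\,\mathrm{d}\mu-Q(f)|=\|m_\mu-\sum_iw_ik(x_i,\cdot)\|_{\mathcal{H}}$. Frank--Wolfe procedure (inputs: $k$, the pool $x_1,\dots,x_N$, the values $m_\mu(x_1),\dots,m_\mu(x_N)$, and $T$): choose $i_0\in\arg\min_{i\in\{1,\dots,N\}}\bigl(k(x_i,x_i)-2m_\mu(x_i)\bigr)$ and set $\bm w^{(0)}:=\bm 1_{i_0}$. For $t=0,1,\dots,T-1$: let $h^{(t)}:=\sum_{i=1}^N w_i^{(t)}k(x_i,\cdot)$, choose $i_t\in\arg\min_{i\in\{1,\dots,N\}}\bigl(h^{(t)}(x_i)-m_\mu(x_i)\bigr)$ (any minimizer), set $\gamma_t:=2/(t+2)$ and $\bm w^{(t+1)}:=(1-\gamma_t)\bm w^{(t)}+\gamma_t\bm 1_{i_t}$. Output $\bm w^{(T)}\in\Delta_N$. *)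

(* Defs.v *)
From HB Require Import structures.
From mathcomp Require Import all_boot all_order all_algebra.
From mathcomp Require Import all_classical all_reals all_analysis.
Set Implicit Arguments. Unset Strict Implicit. Unset Printing Implicit Defensive.
Import Order.TTheory GRing.Theory Num.Theory numFieldNormedType.Exports.
Local Open Scope classical_set_scope.
Local Open Scope ring_scope.

Section Defs.
Variables (R : realType) (X : Type).

Definition pd_kernel (k : X -> X -> R) : Prop :=
  (forall x y, k x y = k y x) /\
  (forall (n : nat) (c : 'I_n -> R) (z : 'I_n -> X),
      0 <= \sum_(i < n) \sum_(j < n) c i * c j * k (z i) (z j)).

Definition is_rkhs (k : X -> X -> R) (H : set (X -> R))
    (ip : (X -> R) -> (X -> R) -> R) : Prop :=
  H (fun _ => 0) /\
      (forall (a : R) f g, H f -> H g -> H (fun x => a * f x + g x)) /\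
      (forall f g, H f -> H g -> ip f g = ip g f) /\
      (forall (a : R) f g h, H f -> H g -> H h ->
          ip (fun x => a * f x + g x) h = a * ip f h + ip g h) /\
      (forall f, H f -> 0 <= ip f f /\ (ip f f = 0 -> f = (fun _ => 0))) /\
      (forall u : nat -> X -> R, (forall n, H (u n)) ->
          (forall e : R, 0 < e -> exists M : nat, forall m n, (M <= m)%N -> (M <= n)%N ->
             ip (fun x => u m x - u n x) (fun x => u m x - u n x) < e) ->
          exists f, H f /\ forall e : R, 0 < e -> exists M : nat, forall n, (M <= n)%N ->
             ip (fun x => u n x - f x) (fun x => u n x - f x) < e) /\
      (forall x, H (k x)) /\
      (forall f x, H f -> ip f (k x) = f x).

Definition kappa (k : X -> X -> R) : R := sup (range (fun x => Num.sqrt (k x x))).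

(* Possible run of the Frank--Wolfe procedure (any choice of minimizers):
   W t is the weight vector w^(t); m i stands for m_mu(x_i). *)
Definition fw_run (N : nat) (k : X -> X -> R) (xs : 'I_N -> X) (m : 'I_N -> R)
    (W : nat -> 'I_N -> R) (T : nat) : Prop :=
  (exists i0 : 'I_N,
      (forall i, k (xs i0) (xs i0) - 2 * m i0 <= k (xs i) (xs i) - 2 * m i) /\
      W 0%N = (fun j => (j == i0)%:R)) /\
  (forall t : nat, (t < T)%N ->
     let h := fun y => \sum_(j < N) W t j * k (xs j) y in
     let g := 2 / (t%:R + 2) in
     exists it : 'I_N,
       (forall i, h (xs it) - m it <= h (xs i) - m i) /\
       W t.+1 = (fun j => (1 - g) * W t j + g * (j == it)%:R)).

End Defs.

Section Meas.
Local Open Scope ereal_scope.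
Context (R : realType) (d : measure_display) (X : measurableType d).

Definition kme (mu : probability X R) (k : X -> X -> R) (y : X) : R :=
  fine (\int[mu]_x (k x y)%:E).

Definition wce (mu : probability X R) (H : set (X -> R))
    (ip : (X -> R) -> (X -> R) -> R) (N : nat) (xs : 'I_N -> X) (w : 'I_N -> R)
    : \bar R :=
  ereal_sup [set `| \int[mu]_x (f x)%:E - (\sum_(i < N) w i * f (xs i))%:E |
            | f in [set f | H f /\ (ip f f <= 1)%R]].

Definition orthonormal_L2 (mu : probability X R) (e : nat -> X -> R) : Prop :=
  (forall j, measurable_fun setT (e j)) /\
  (forall i j, \int[mu]_x (e i x * e j x)%:E = ((i == j)%:R)%:E).

Definition iid_with_law {dO : measure_display} {Omega : measurableType dO}
    (P : probability Omega R) (mu : probability X R) (N : nat)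
    (Xs : 'I_N -> Omega -> X) : Prop :=
  (forall i, measurable_fun setT (Xs i)) /\
  (forall A : 'I_N -> set X, (forall i, measurable (A i)) ->
     P [set om | forall i, A i (Xs i om)] = \prod_(i < N) mu (A i)).

End Meas.

(* Main.v *)
Require Import Defs.
From HB Require Import structures.
From mathcomp Require Import all_boot all_order all_algebra.
From mathcomp Require Import all_classical all_reals all_analysis.
From mathcomp Require Import measurable_realfun ring lra.
Import Order.TTheory GRing.Theory Num.Theory numFieldNormedType.Exports.
Set Implicit Arguments.
Unset Strict Implicit.
Unset Printing Implicit Defensive.
Local Open Scope classical_set_scope.
Local Open Scope ring_scope.

(* Embed everything in the RKHS. The Frank-Wolfe recursion g(t+1) <= (1 - gamma) g(t) + 4 kappa^2
   gamma^2 for the excess of the squared error bounds the error of the output by that of any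
   convex weights plus 4 kappa / sqrt(T + 2), so it suffices to find good convex weights.

   Map x to the vector of its first d Mercer features together with the norm of the remaining
   ones; this lives in dimension D = d + 1 and has norm at most kappa. If a convex combination of
   the sampled vectors is within beta of the mean vector, its worst-case error is at most
   2 sqrt(sum_{j>d} sigma_j) + beta. By Markov, every half-space at distance 2 kappa / n beyond the
   mean has mass at most n / (n + 1).

   Suppose the hull of the centred sample stays away from 0. Its point nearest to 0 is a convex
   combination of at most D sample points, and it is already the nearest point for every
   subsample containing them. Split the sample into 2D blocks of at least 3n points: some D blocks
   determine a half-space containing all the points of the other blocks. A union bound over
   at most 4^D choices of blocks gives failure probability at most 4^D (n/(n+1))^(3nD) <= 2^(-D).
   Rounding the vectors to a finite grid (at the cost of kappa / n twice in the distance) turns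
   this into a finite computation with product weights, so that neither a measurable selection of
   the nearest point nor Fubini is needed. *)

(** * Convex geometry in finite dimension: nearest points of hulls and Caratheodory reduction *)

Section FiniteDimensionalGeometry.
Variable R : realType.

Definition dot (D : nat) (u v : 'I_D -> R) : R := \sum_(j < D) u j * v j.

Definition comb (N D : nat) (w : 'I_N -> R) (y : 'I_N -> 'I_D -> R) : 'I_D -> R :=
  fun j => \sum_(i < N) w i * y i j.

Definition simplex (N : nat) (w : 'I_N -> R) : Prop :=
  (forall i, 0 <= w i) /\ \sum_(i < N) w i = 1.

Lemma dotC D (u v : 'I_D -> R) : dot u v = dot v u.
Proof. by apply: eq_bigr => j _; rewrite mulrC. Qed.

Lemma dot_ge0 D (u : 'I_D -> R) : 0 <= dot u u.
Proof. by apply: sumr_ge0 => j _; rewrite -expr2 sqr_ge0. Qed.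

Lemma dot_eq0 D (u : 'I_D -> R) : dot u u = 0 -> forall j, u j = 0.
Proof.
move=> /eqP; rewrite psumr_eq0 => [/allP u0 j|j _]; last by rewrite -expr2 sqr_ge0.
by have /(_ (mem_index_enum j)) := u0 j; rewrite /= mulf_eq0 orbb => /eqP.
Qed.

Lemma dotDl D (u v z : 'I_D -> R) (a : R) :
  dot (fun j => u j + a * v j) z = dot u z + a * dot v z.
Proof.
by rewrite /dot mulr_sumr -big_split /=; apply: eq_bigr => j _; rewrite mulrDl mulrA.
Qed.

Lemma dotDr D (u v z : 'I_D -> R) (a : R) :
  dot z (fun j => u j + a * v j) = dot z u + a * dot z v.
Proof. by rewrite dotC dotDl !(dotC z). Qed.

Lemma dot_combr N D (u : 'I_D -> R) (w : 'I_N -> R) (y : 'I_N -> 'I_D -> R) :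
  dot u (comb w y) = \sum_i w i * dot u (y i).
Proof.
rewrite /dot /comb; under eq_bigr do rewrite mulr_sumr.
rewrite exchange_big /=; apply: eq_bigr => i _; rewrite mulr_sumr.
by apply: eq_bigr => j _; rewrite mulrCA.
Qed.

(** The quadratic is evaluated at its minimizer [- B / A]; if [A = 0] and [B] is nonzero, the chosen
    [t] makes it equal to -1. Both the weighted and the RKHS Cauchy-Schwarz inequalities rest on
    this. *)
Lemma quadratic_ge0_discr (A B C : R) : 0 <= A -> 0 <= C ->
  (forall t, 0 <= t ^+ 2 * A + 2 * t * B + C) -> B ^+ 2 <= A * C.
Proof.
move=> A0 C0 h; have [AE|AN] := eqVneq A 0.
  rewrite AE mul0r; have [->|BN] := eqVneq B 0; first by rewrite expr0n.
  have := h (- (C + 1) / (2 * B)); rewrite AE mulr0 add0r.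
  have -> : 2 * (- (C + 1) / (2 * B)) * B = - (C + 1) by field.
  lra.
have Ap : 0 < A by rewrite lt_def AN.
have := h (- B / A).
have -> : (- B / A) ^+ 2 * A + 2 * (- B / A) * B + C = (A * C - B ^+ 2) / A by field.
by rewrite pmulr_lge0 ?invr_gt0 // subr_ge0.
Qed.

(** The quadratic in [t] is the sum of the [s j * (t * u j + v j) ^+ 2]. Weights 1 give the
    Euclidean inequality, weights [sigma] the one between Mercer coefficients. *)
Lemma weighted_cauchy_schwarz (I : Type) (r : seq I) (s u v : I -> R) :
  (forall j, 0 <= s j) ->
  (\sum_(j <- r) s j * u j * v j) ^+ 2 <=
    (\sum_(j <- r) s j * u j ^+ 2) * (\sum_(j <- r) s j * v j ^+ 2).
Proof.
move=> s0; apply: quadratic_ge0_discr.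
- by apply: sumr_ge0 => j _; rewrite mulr_ge0 // sqr_ge0.
- by apply: sumr_ge0 => j _; rewrite mulr_ge0 // sqr_ge0.
- move=> t; rewrite !mulr_sumr -!big_split /=; apply: sumr_ge0 => j _.
  have -> : t ^+ 2 * (s j * u j ^+ 2) + 2 * t * (s j * u j * v j) + s j * v j ^+ 2 =
    s j * (t * u j + v j) ^+ 2 by ring.
  by rewrite mulr_ge0 // sqr_ge0.
Qed.

Lemma dot_cauchy_schwarz D (u v : 'I_D -> R) : dot u v ^+ 2 <= dot u u * dot v v.
Proof.
have := @weighted_cauchy_schwarz _ (index_enum 'I_D) (fun _ => 1) u v (fun _ => ler01).
by rewrite /dot; under eq_bigr do rewrite mul1r; under [X in _ <= X * _]eq_bigr do rewrite mul1r;
  under [X in _ <= _ * X]eq_bigr do rewrite mul1r.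
Qed.

Lemma dot_le D (a c : 'I_D -> R) (x y : R) : 0 <= x -> 0 <= y ->
  dot a a <= x ^+ 2 -> dot c c <= y ^+ 2 -> dot a c <= x * y.
Proof.
move=> x0 y0 ax cy; apply: le_trans (ler_norm _) _.
rewrite -(ler_pXn2r (ltn0Sn 1)) ?nnegrE ?mulr_ge0 // real_normK ?num_real //.
apply: le_trans (dot_cauchy_schwarz _ _) _; rewrite exprMn.
by apply: ler_pM; rewrite ?dot_ge0.
Qed.

(** Both arguments of [dot] expand into averages of the terms [dot (r i) (r l)]. This keeps rounding
    errors under control in convex combinations. *)
Lemma dot_comb_le N D (w : 'I_N -> R) (r : 'I_N -> 'I_D -> R) (x : R) : 0 <= x -> simplex w ->
  (forall i, dot (r i) (r i) <= x ^+ 2) -> dot (comb w r) (comb w r) <= x ^+ 2.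
Proof.
move=> x0 [w0 w1] rx; have avg (f : 'I_N -> R) : (forall i, f i <= x ^+ 2) ->
    \sum_i w i * f i <= x ^+ 2.
  move=> fx; rewrite -[leRHS]mul1r -w1 mulr_suml; apply: ler_sum => i _.
  by rewrite ler_wpM2l.
rewrite dot_combr; apply: (avg) => i; rewrite dotC dot_combr; apply: (avg) => l.
by rewrite expr2; exact: dot_le.
Qed.

(** Applied with [x = 1/n], it turns the half-space mass [n / (n + 1)] into at most 1/2 after [n]
    independent points. *)
Lemma bernoulli_ineq (x : R) n : 0 <= x -> 1 + n%:R * x <= (1 + x) ^+ n.
Proof.
move=> x0; elim: n => [|n IH]; first by rewrite mul0r addr0 expr0.
have x1 : 0 <= 1 + x by rewrite addr_ge0.
rewrite exprS; apply: le_trans (ler_wpM2l x1 IH).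
have : 0 <= n%:R * x ^+ 2 by rewrite mulr_ge0 ?ler0n ?sqr_ge0.
rewrite -natr1; move: (n%:R) => m; lra.
Qed.

Lemma continuous_sum (T : topologicalType) (I : Type) (r : seq I) (F : I -> T -> R) :
  (forall i, continuous (F i)) -> continuous (fun x => \sum_(i <- r) F i x).
Proof.
by move=> Fc x; apply: cvg_big => [|i _]; [exact: add_continuous|exact: Fc].
Qed.

Lemma compact_simplex N : compact [set v : 'rV[R]_N | simplex (v ord0)].
Proof.
apply: bounded_closed_compact.
  exists 1; split=> // M M1 v [v0 v1] /=.
  apply: le_trans (ltW M1); rewrite [leLHS]mx_normrE.
  apply: bigmax_le => // -[i j] _ /=; rewrite ord1 ger0_norm // -v1.
  by rewrite (bigD1 j) //= lerDl sumr_ge0.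
have -> : [set v : 'rV[R]_N | simplex (v ord0)] =
    \bigcap_(i in [set: 'I_N]) ((fun v : 'rV[R]_N => v ord0 i) @^-1` [set x | 0 <= x])
    `&` ((fun v : 'rV[R]_N => \sum_(i < N) v ord0 i) @^-1` [set 1]).
  apply/seteqP; split => v /=.
    by case=> v0 v1; split=> // i _; exact: v0.
  by case=> v0 v1; split=> // i; exact: (v0 i).
apply: closedI.
  apply: closed_bigI => i _; apply: closed_comp; last exact: closed_ge.
  by move=> v _; exact: coord_continuous.
apply: closed_comp; last exact: closed_eq.
move=> v _; apply: (@continuous_sum 'rV[R]_N 'I_N) => i.
exact: coord_continuous.
Qed.

(* The variational inequality characterizing the point of a convex hull nearest to 0. *)
Lemma nearest_point N D (y : 'I_N -> 'I_D -> R) : (0 < N)%N ->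
  exists2 w, simplex w &
    forall i, dot (comb w y) (comb w y) <= dot (comb w y) (y i).
Proof.
case: N y => // N y _.
pose f (v : 'rV[R]_N.+1) := dot (comb (v ord0) y) (comb (v ord0) y).
have fc : continuous f.
  apply: (@continuous_sum 'rV[R]_N.+1 'I_D) => j.
  have hc : continuous (fun u : 'rV[R]_N.+1 => comb (u ord0) y j).
    apply: (@continuous_sum 'rV[R]_N.+1 'I_N.+1) => i u.
    apply: (@continuousM R 'rV[R]_N.+1 (fun v => v ord0 i) (cst (y i j))).
      exact: coord_continuous.
    exact: cst_continuous.
  move=> u; exact: (continuousM (hc u) (hc u)).
have S0 : [set v : 'rV[R]_N.+1 | simplex (v ord0)] !=set0.
  exists (\row_i (i == ord0)%:R); split=> [i|]; first by rewrite mxE ler0n.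
  by rewrite (bigD1 ord0) //= mxE eqxx big1 ?addr0 // => i /negPf; rewrite mxE => ->.
have [v /set_mem vs vmin] :=
  EVT_min_rV S0 (@compact_simplex N.+1) (continuous_subspaceT fc).
exists (v ord0) => // i; case: vs => v0 v1.
set p := comb (v ord0) y; set z := fun j => y i j - p j.
rewrite -subr_ge0; set a := _ - _; rewrite leNgt; apply/negP => a0.
set b := dot z z; have b0 : 0 <= b by exact: dot_ge0.
(* Moving from [p] toward [y i] by [t] changes the squared norm by [2 t a + t^2 b], at most
   [t a < 0] once [t b <= - a]; this contradicts minimality. *)
have [t [t0 t1 tb]] : exists t, [/\ 0 < t, t <= 1 & t * b <= - a].
  have ba : 0 < b - a by lra.
  exists (- a / (b - a)); split; first by rewrite divr_gt0 //; lra.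
    by rewrite ler_pdivrMr //; lra.
  by rewrite mulrAC ler_pdivrMr // ler_pM2l; lra.
pose u : 'rV[R]_N.+1 := \row_l ((1 - t) * v ord0 l + t * (l == i)%:R).
have us : simplex (u ord0).
  split=> [l|]; first by rewrite mxE addr_ge0 // mulr_ge0 ?subr_ge0 ?ler0n ?(ltW t0).
  under eq_bigr do rewrite mxE; rewrite big_split /= -!mulr_sumr v1.
  by rewrite (bigD1 i) //= eqxx big1 ?addr0 ?mulr1 ?subrK // => l /negPf ->.
have uE : comb (u ord0) y = fun j => p j + t * z j.
  apply/funext => j; rewrite /comb; under eq_bigr do rewrite mxE mulrDl -!mulrA.
  rewrite big_split /= -!mulr_sumr -/(comb _ _ _) -/p (bigD1 i) //= eqxx big1.
    rewrite addr0 mul1r /z /p /comb; ring.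
  by move=> l /negPf ->; rewrite mul0r.
have pz : dot p z = a.
  rewrite /a /z.
  have -> : (fun j => y i j - p j) = (fun j => y i j + (-1) * p j).
    by apply/funext => j; rewrite mulN1r.
  by rewrite dotDr mulN1r.
have := vmin u (mem_set us); rewrite /f uE dotDl !dotDr -/p -/b.
rewrite (dotC z) pz.
nra.
Qed.

(** Testing each inequality against the other hull point bounds both squared norms by the mutual dot
    product, so the difference has norm 0. Hence the half-space cut out by the nearest point depends
    only on the points indexed by [J], whichever weights represent it. *)
Lemma nearest_point_uniq N D (w w' : 'I_N -> R) (y : 'I_N -> 'I_D -> R)
    (J : {set 'I_N}) :
  simplex w -> simplex w' ->
  (forall i, i \notin J -> w i = 0) -> (forall i, i \notin J -> w' i = 0) ->
  (forall i, i \in J -> dot (comb w y) (comb w y) <= dot (comb w y) (y i)) ->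
  (forall i, i \in J -> dot (comb w' y) (comb w' y) <= dot (comb w' y) (y i)) ->
  comb w y = comb w' y.
Proof.
have key (u v : 'I_N -> R) : simplex v -> (forall i, i \notin J -> v i = 0) ->
    (forall i, i \in J -> dot (comb u y) (comb u y) <= dot (comb u y) (y i)) ->
    dot (comb u y) (comb u y) <= dot (comb u y) (comb v y).
  move=> [v0 v1] vJ uJ; rewrite [leRHS]dot_combr -[leLHS]mul1r -v1 mulr_suml.
  apply: ler_sum => i _; case: (boolP (i \in J)) => [iJ|/vJ ->]; last by rewrite !mul0r.
  by rewrite ler_wpM2l // uJ.
move=> ws ws' wJ w'J wy w'y.
have h1 := key w w' ws' w'J wy; have h2 := key w' w ws wJ w'y.
have h : dot (fun j => comb w y j + (-1) * comb w' y j)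
            (fun j => comb w y j + (-1) * comb w' y j) = 0.
  apply/eqP; rewrite eq_le dot_ge0 andbT.
  rewrite dotDl !dotDr (dotC (comb w' y) (comb w y)) in h1 h2 *.
  by lra.
apply/funext => j; apply/eqP; rewrite -subr_eq0 -mulN1r.
by apply/eqP; exact: (dot_eq0 h j).
Qed.

(** A matrix with more than [D] rows and [D] columns has a nonzero left kernel vector, which is
    extended by 0 outside [S]. *)
Lemma linear_dependence N D (y : 'I_N -> 'I_D -> R) (S : {set 'I_N}) :
  (D < #|S|)%N ->
  exists a : 'I_N -> R, [/\ forall i, i \notin S -> a i = 0,
    exists i, a i != 0 & forall j, \sum_i a i * y i j = 0].
Proof.
move=> DS.
pose A : 'M[R]_(#|S|, D) := \matrix_(l, j) y (enum_val l) j.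
have : kermx A != 0.
  rewrite kermx_eq0 /row_free neq_ltn; apply/orP; left.
  by rewrite (leq_ltn_trans (rank_leq_col _)).
case/rowV0Pn => u /sub_kermxP uA u0.
pose a i : R := \sum_l u ord0 l * (i == enum_val l)%:R.
have aE l : a (enum_val l) = u ord0 l.
  rewrite /a (bigD1 l) //= eqxx mulr1 big1 ?addr0 // => m ml.
  by rewrite (inj_eq enum_val_inj) eq_sym (negPf ml) mulr0.
have asum (g : 'I_N -> R) : \sum_i a i * g i = \sum_l u ord0 l * g (enum_val l).
  under eq_bigr do rewrite mulr_suml.
  rewrite exchange_big /=; apply: eq_bigr => l _.
  rewrite (bigD1 (enum_val l)) //= eqxx mulr1 big1 ?addr0 // => i /negPf ->.
  by rewrite mulr0 mul0r.
exists a; split=> [i iS||j].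
- rewrite /a big1 // => l _; case: eqP => [il|]; last by rewrite mulr0.
  by move: iS; rewrite il enum_valP.
- have [l ul] : exists l, u ord0 l != 0.
    apply/existsP; rewrite -negb_forall; apply: contra u0 => /forallP u0.
    by apply/eqP/rowP => l; rewrite mxE; exact/eqP.
  by exists (enum_val l); rewrite aE.
- rewrite asum; have := congr1 (fun B : 'rV[R]_D => B ord0 j) uA; rewrite !mxE => uAj.
  by rewrite -[RHS]uAj; apply: eq_bigr => l _; rewrite mxE.
Qed.

Definition wsupp (N : nat) (w : 'I_N -> R) : {set 'I_N} := [set i | w i != 0]%SET.

(* All the points carrying weight lie on the hyperplane [dot p q = dot p p], which misses 0;
   hence Caratheodory's bound is [D] rather than [D + 1]. *)
Lemma nearest_point_caratheodory N D (w : 'I_N -> R) (y : 'I_N -> 'I_D -> R) :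
  simplex w ->
  (forall i, dot (comb w y) (comb w y) <= dot (comb w y) (y i)) ->
  0 < dot (comb w y) (comb w y) ->
  exists w', [/\ simplex w', comb w' y = comb w y & (#|wsupp w'| <= D)%N].
Proof.
have [n] := ubnP #|wsupp w|; elim: n w => // n IH w wn ws wy p0.
have [wD|Dw] := leqP #|wsupp w| D; first by exists w.
have [a [aS [i0 ai0] ay]] := linear_dependence y Dw.
case: (ws) => w0 w1; set p := comb w y in wy p0 *.
have a_w i : a i != 0 -> w i != 0.
  by apply: contraNneq => wi; apply/eqP/aS; rewrite inE wi eqxx.
(* Complementary slackness: the terms [w i * (dot p (y i) - dot p p)] are nonnegative and sum to
   0. *)
have supp i : w i != 0 -> dot p (y i) = dot p p.
  have h : \sum_i w i * (dot p (y i) - dot p p) = 0.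
    under eq_bigr do rewrite mulrBr.
    by rewrite sumrB -mulr_suml w1 mul1r -dot_combr subrr.
  move=> wi; have := @psumr_eq0P _ _ predT (fun i => w i * (dot p (y i) - dot p p)).
  move=> /(_ (fun i _ => mulr_ge0 (w0 i) _)) h'.
  have {h'}/(_ i isT)/eqP := h' (fun i => etrans (subr_ge0 _ _) (wy i)) h.
  by rewrite mulf_eq0 (negPf wi) /= subr_eq0 => /eqP.
(* On the support [dot p (y i)] is the nonzero constant [dot p p], so the linear relation is
   automatically an affine one. *)
have a0 : \sum_i a i = 0.
  have : \sum_i a i * dot p (y i) = 0.
    by rewrite -dot_combr /dot big1 // => j _; rewrite /comb ay mulr0.
  have -> : \sum_i a i * dot p (y i) = (\sum_i a i) * dot p p.
    rewrite mulr_suml; apply: eq_bigr => i _.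
    by have [->|/a_w/supp ->] := eqVneq (a i) 0; rewrite ?mul0r.
  by move/eqP; rewrite mulf_eq0 (gt_eqF p0) orbF => /eqP.
have [i1 ai1] : exists i, 0 < a i.
  apply: contrapT => /forallNP aN.
  have aN' i : 0 <= - a i by rewrite oppr_ge0 leNgt; apply/negP/aN.
  have : \sum_i - a i = 0 by rewrite sumrN a0 oppr0.
  move/(@psumr_eq0P _ _ predT _ (fun i _ => aN' i))/(_ i0 isT)/eqP.
  by rewrite oppr_eq0 (negPf ai0).
(* The least ratio [w i / a i] over positive [a i] is the longest step along [- a] that keeps the
   weights nonnegative; it annihilates the weight of index [m]. *)
case: (@Order.TotalTheory.arg_minP _ _ _ i1 (fun i => 0 < a i) (fun i => w i / a i) ai1).
move=> m am mmin; pose t := w m / a m.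
have t0 : 0 <= t by rewrite divr_ge0 // ltW.
pose w' i := w i - t * a i.
have pE : comb w' y = p.
  apply/funext => j; rewrite /comb; under eq_bigr do rewrite mulrBl -mulrA.
  by rewrite sumrB -mulr_sumr ay mulr0 subr0.
have w's : simplex w'.
  split=> [i|]; last by rewrite sumrB -mulr_sumr a0 mulr0 subr0.
  rewrite subr_ge0; have [ai|ai] := ltP 0 (a i); first by rewrite -ler_pdivlMr // mmin.
  by rewrite (le_trans _ (w0 i)) // mulr_ge0_le0.
rewrite -/p -pE; apply: IH => //; rewrite ?pE //.
rewrite -ltnS; apply: leq_trans wn; rewrite ltnS; apply/proper_card/properP; split.
  apply/fintype.subsetP => i; rewrite !inE; apply: contraNneq => wi.
  by rewrite /w' wi aS ?inE ?wi ?eqxx // mulr0 subrr.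
exists m; rewrite !inE; first by apply: a_w; rewrite gt_eqF.
by rewrite negbK /w' /t mulfVK ?(gt_eqF am) // subrr.
Qed.

End FiniteDimensionalGeometry.

(** * Product weights on a finite sample space and the probability of a bad sample *)

Section FiniteSampling.
Variables (R : realType) (F : finType) (p : F -> R).
Hypotheses (p_ge0 : forall v, 0 <= p v) (p_sum1 : \sum_v p v = 1).

Lemma prod_sample_sum N : \sum_(s : {ffun 'I_N -> F}) \prod_i p (s i) = 1.
Proof. by rewrite -(bigA_distr_bigA (fun _ => p)) big1. Qed.

(* Fubini for finite products: conditionally on the coordinates in [J], the event [A s] is
   fixed, and the other coordinates hit it independently. *)
Lemma sample_split_bound N (J : {set 'I_N}) (A : {ffun 'I_N -> F} -> pred F) (q : R) :
  (forall s s' : {ffun 'I_N -> F}, (forall i, i \in J -> s i = s' i) -> A s =1 A s') ->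
  (forall s, \sum_(v | A s v) p v <= q) -> 0 <= q ->
  \sum_(s : {ffun 'I_N -> F} | [forall i, (i \notin J) ==> A s (s i)]) \prod_i p (s i)
    <= q ^+ #|~: J|.
Proof.
move=> AJ Aq q0.
have [v0 _] : exists v : F, true.
  apply/existsP; apply: contraT => /existsPn h; move/eqP: p_sum1.
  by rewrite big1 1?eq_sym ?oner_eq0 // => v _; have := h v.
(* [r] erases the coordinates outside [J]; its fibres play the role of conditioning on those in [J].
   A fibre over [t] is empty unless [r t = t]. *)
pose r (s : {ffun 'I_N -> F}) : {ffun 'I_N -> F} := [ffun i => if i \in J then s i else v0].
have -> : q ^+ #|~: J| = q ^+ #|~: J| * \sum_(s : {ffun 'I_N -> F}) \prod_i p (s i).
  by rewrite prod_sample_sum mulr1.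
rewrite (partition_big r predT) //= [X in _ <= _ * X](partition_big r predT) //= mulr_sumr.
apply: ler_sum => t _.
have rrE s i : i \in J -> r s = t -> t i = s i by move=> iJ <-; rewrite ffunE iJ.
have [rt|/negP rt] := boolP (r t == t); last first.
  rewrite big_pred0; first by rewrite mulr_ge0 ?exprn_ge0 // sumr_ge0 // => s _;
    exact: prodr_ge0.
  move=> s; apply/negP => /andP[_ /eqP rs]; apply: rt; apply/eqP/ffunP => i.
  by rewrite -rs /r !ffunE; case: ifP => [->|].
(* Pinning the coordinates in [J] to [t] and constraining the others by [B] gives a product set, so
   its weight factors. *)
pose Q (B : pred F) i : pred F := fun v => if i \in J then v == t i else B v.
have QE (B : pred F) : \sum_(s in family (Q B)) \prod_i p (s i) =
    (\sum_(v | B v) p v) ^+ #|~: J| * \prod_(i in J) p (t i).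
  rewrite -(bigA_distr_big_dep (Q B) (fun _ => p)) (bigID (mem J)) /= mulrC; congr (_ * _).
    rewrite -prodr_const; apply: eq_big => [i|i iJ]; first by rewrite inE.
    by apply: eq_bigl => v; rewrite /Q (negPf iJ).
  by apply: eq_bigr => i iJ; rewrite (big_pred1 (t i)) // => v; rewrite /Q iJ.
have -> : \sum_(s | r s == t) \prod_i p (s i) = \prod_(i in J) p (t i).
  have := QE predT; rewrite p_sum1 expr1n mul1r => <-; apply: eq_bigl => s.
  apply/eqP/familyP => [rs i|h].
    by rewrite unfold_in /Q; case: ifP => // iJ; apply/eqP/esym/rrE.
  apply/ffunP => i; rewrite ffunE; have := h i; rewrite unfold_in /Q; case: ifP => iJ.
    by move/eqP.
  by have /eqP/ffunP/(_ i) := rt; rewrite ffunE iJ.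
apply: (@le_trans _ _ (\sum_(s in family (Q (A t))) \prod_i p (s i))).
  rewrite [leRHS](bigID (fun s => [forall i, (i \notin J) ==> A s (s i)] && (r s == t))) /=.
  rewrite -[leLHS]addr0; apply: lerD; last by apply: sumr_ge0 => s _; exact: prodr_ge0.
  rewrite le_eqVlt; apply/orP; left; apply/eqP/eq_bigl => s.
  apply/idP/andP => [/[dup] /andP[/forallP sA /eqP rs] h|[]//]; split=> //.
  apply/familyP => i; rewrite unfold_in /Q; case: ifP => iJ.
    by apply/eqP/esym/rrE.
  rewrite -(AJ s t); first by have := sA i; rewrite iJ.
  by move=> l lJ; apply/esym/rrE.
rewrite QE ler_wpM2r ?prodr_ge0 // lerXn2r ?nnegrE // sumr_ge0 //.
Qed.

(** A bad sample has a nearest point carried by at most [D] sample points. The blocks containing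
    them fix a half-space of mass at most [q], which every point of the remaining blocks must hit;
    the union bound runs over the choices of blocks. *)
Lemma bad_sample_bound N D n (y : F -> 'I_D -> R) (eps q : R) :
  (0 < D)%N -> (0 < N)%N -> (6 * D * n <= N)%N -> 0 <= eps -> 0 <= q <= 1 -> q ^+ n <= 2^-1 ->
  (forall c, 0 < dot c c ->
     \sum_(v | eps * Num.sqrt (dot c c) < dot c (y v)) p v <= q) ->
  \sum_(s : {ffun 'I_N -> F} |
        ~~ `[< exists2 w, simplex w & dot (comb w (y \o s)) (comb w (y \o s)) <= eps ^+ 2 >])
     \prod_i p (s i) <= 2 ^- D.
Proof.
move=> D0 N0 DnN eps0 /andP[q0 q1] qn hq.
have D20 : (0 < 2 * D)%N by rewrite muln_gt0.
(* Blocks are residue classes modulo [2 * D], so [6 * D * n <= N] leaves at least [3 * n] indices in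
   each. *)
pose blk (i : 'I_N) : 'I_(2 * D) := Ordinal (ltn_pmod i D20).
pose J (K : {set 'I_(2 * D)}) : {set 'I_N} := [set i | blk i \in K]%SET.
pose near (K : {set 'I_(2 * D)}) (s : {ffun 'I_N -> F}) (w : 'I_N -> R) :=
  [/\ simplex w, forall i, i \notin J K -> w i = 0,
      0 < dot (comb w (y \o s)) (comb w (y \o s)) &
      forall i, i \in J K ->
        dot (comb w (y \o s)) (comb w (y \o s)) <= dot (comb w (y \o s)) (y (s i))].
pose A K s v := `[< exists2 w, near K s w &
   eps * Num.sqrt (dot (comb w (y \o s)) (comb w (y \o s))) < dot (comb w (y \o s)) (y v) >].
have AJ K (s s' : {ffun 'I_N -> F}) : (forall i, i \in J K -> s i = s' i) -> A K s =1 A K s'.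
  have key (s1 s2 : {ffun 'I_N -> F}) v : (forall i, i \in J K -> s1 i = s2 i) -> A K s1 v -> A K s2 v.
    move=> s12 /asboolP[w [ws wJ wp wy] wv].
    have cE : comb w (y \o s1) = comb w (y \o s2).
      apply/funext => j; apply: eq_bigr => i _ /=.
      by have [/s12 ->|/wJ ->] := boolP (i \in J K); rewrite ?mul0r.
    apply/asboolP; exists w; rewrite -?cE //; split=> //; rewrite -cE // => i iJ.
    by rewrite -s12 // wy.
  move=> ss' v; apply/idP/idP; apply: key => // i iJ; by rewrite ss'.
(* All witnesses [w] yield the same nearest point, so [A K s] is either empty or a single half-space
   covered by [hq]. *)
have Aq K s : \sum_(v | A K s v) p v <= q.
  have [[w wn]|nw] := pselect (exists w, near K s w); last first.
    rewrite big_pred0 // => v; apply/asboolP => -[w wn _]; apply: nw; by exists w.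
  case: (wn) => ws wJ wp wy; apply: le_trans (hq _ wp).
  rewrite le_eqVlt; apply/orP; left; apply/eqP/eq_bigl => v.
  apply/asboolP/idP => [[w' [w's w'J w'p w'y]]|]; last by exists w.
  by rewrite (nearest_point_uniq ws w's wJ w'J wy w'y).
(* At least [D] blocks lie outside [K]; the map [g] injects [3 * n] indices [b + t * (2 * D)] into
   each block [b]. *)
have cardJ (K : {set 'I_(2 * D)}) : (#|K| <= D)%N -> (n * (3 * D) <= #|~: J K|)%N.
  move=> KD.
  have gP (z : 'I_(2 * D) * 'I_(3 * n)) : (z.1 + z.2 * (2 * D) < N)%N.
    apply: leq_trans DnN; case: z => [b t] /=.
    have -> : (6 * D * n = (3 * n) * (2 * D))%N by ring.
    apply: (@leq_trans ((t.+1) * (2 * D))); first by rewrite [ltnRHS]mulSn ltn_add2r ltn_ord.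
    by rewrite leq_mul2r ltn_ord orbT.
  pose g z : 'I_N := Ordinal (gP z).
  have gb z : blk (g z) = z.1.
    by apply: val_inj => /=; rewrite addnC modnMDl modn_small.
  have ginj : injective g.
    move=> [b t] [b' t'] /[dup] /(congr1 blk); rewrite !gb /= => <-.
    move=> /(congr1 val) /= /eqP; rewrite eqn_add2l eqn_mul2r muln_eq0 /= (gtn_eqF D0) /=.
    by move=> /eqP/val_inj ->.
  have -> : (n * (3 * D) = D * (3 * n))%N by ring.
  apply: (@leq_trans #|finset.setX (~: K) [set: 'I_(3 * n)]%SET|).
    rewrite cardsX cardsT card_ord leq_mul2r; apply/orP; right.
    rewrite -(leq_add2l #|K|) cardsC card_ord.
    by apply: (@leq_trans (D + D)); [rewrite leq_add2r|rewrite addnn mul2n].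
  rewrite -(card_imset _ ginj); apply: subset_leq_card.
  apply/fintype.subsetP => _ /imsetP[z zK ->]; rewrite !inE in zK *.
  by rewrite gb; case/andP: zK.
pose B K s := [forall i, (i \notin J K) ==> A K s (s i)].
have badB (s : {ffun 'I_N -> F}) :
    ~~ `[< exists2 w, simplex w & dot (comb w (y \o s)) (comb w (y \o s)) <= eps ^+ 2 >] ->
    exists K : {set 'I_(2 * D)}, (#|K| <= D)%N && B K s.
  move=> /asboolPn bad; have [w ws wy] := nearest_point (y \o s) N0.
  have pe : eps ^+ 2 < dot (comb w (y \o s)) (comb w (y \o s)).
    by rewrite ltNge; apply/negP => h; apply: bad; exists w.
  have p0 := le_lt_trans (sqr_ge0 eps) pe.
  have [w' [w's w'p w'D]] := nearest_point_caratheodory ws wy p0.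
  exists (blk @: wsupp w'); rewrite (leq_trans (leq_imset_card _ _)) //=.
  apply/forallP => i; apply/implyP => iJ; apply/asboolP; exists w'.
    rewrite /near w'p; split=> // [l|l _]; last exact: wy.
    by apply: contraNeq => wl; rewrite inE; apply: imset_f; rewrite inE.
  (* The norm of the nearest point exceeds [eps], hence [eps] times this norm is below its square,
     which bounds [dot p (y (s i))] from below. *)
  rewrite w'p (lt_le_trans _ (wy i)) //.
  rewrite -[ltRHS]sqr_sqrtr ?(ltW p0) // expr2 ltr_pM2r ?sqrtr_gt0 //.
  by rewrite -(ltr_pXn2r (ltn0Sn 1)) ?nnegrE ?sqrtr_ge0 // sqr_sqrtr // ltW.
apply: (@le_trans _ _ (\sum_(K : {set 'I_(2 * D)} | (#|K| <= D)%N)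
     \sum_(s : {ffun 'I_N -> F} | B K s) \prod_i p (s i))).
  rewrite (exchange_big_dep predT) //= [leRHS](bigID (fun s : {ffun 'I_N -> F} =>
    ~~ `[< exists2 w, simplex w & dot (comb w (y \o s)) (comb w (y \o s)) <= eps ^+ 2 >])) /=.
  rewrite -[leLHS]addr0; apply: lerD; last first.
    by do 2![apply: sumr_ge0 => ? _]; exact: prodr_ge0.
  apply: ler_sum => s /badB[K KB]; rewrite (bigD1 K) //= lerDl.
  by apply: sumr_ge0 => ? _; exact: prodr_ge0.
apply: (@le_trans _ _ (\sum_(K : {set 'I_(2 * D)}) (2^-1) ^+ (3 * D))).
  rewrite [leRHS](bigID (fun K : {set 'I_(2 * D)} => (#|K| <= D)%N)) /=.
  rewrite -[leLHS]addr0; apply: lerD; last by apply: sumr_ge0 => ? _; rewrite exprn_ge0.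
  apply: ler_sum => K KD; apply: le_trans (sample_split_bound (AJ K) (Aq K) q0) _.
  apply: (@le_trans _ _ (q ^+ (n * (3 * D)))); first by rewrite ler_wiXn2l // cardJ.
  by rewrite exprM lerXn2r // nnegrE ?exprn_ge0.
(* There are [2 ^ (2 * D)] sets [K], each contributing [2 ^- (3 * D)]. *)
have -> : (3 * D = 2 * D + D)%N by ring.
rewrite sumr_const -cardsT -powersetT card_powerset cardsT card_ord.
rewrite -[leLHS]mulr_natl natrX exprD mulrA -exprMn mulfV ?pnatr_eq0 // expr1n mul1r.
by rewrite exprVn.
Qed.

End FiniteSampling.

(** * Convergence rate of the Frank-Wolfe iteration *)

Section FrankWolfe.
Variables (R : realType) (X : Type).

Definition qform (N : nat) (G : 'I_N -> 'I_N -> R) (a b : 'I_N -> R) : R :=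
  \sum_i \sum_j a i * b j * G i j.

(* Squared RKHS distance between the embedding of mu and that of the weights w; [C] stands for
   the squared norm of the mean embedding. *)
Definition risk (N : nat) (C : R) (k : X -> X -> R) (xs : 'I_N -> X) (m w : 'I_N -> R) : R :=
  C - 2 * \sum_i w i * m i + qform (fun i j => k (xs i) (xs j)) w w.

(** Positivity at the two points [x], [y] with coefficients (1, 1) and (1, -1). *)
Lemma pd_kernel_le (k : X -> X -> R) (b : R) :
  pd_kernel k -> (forall x, k x x <= b) -> forall x y, `|k x y| <= b.
Proof.
move=> [ks kp] kb x y; rewrite ler_norml.
pose z (i : 'I_2) := if i == ord0 then x else y.
have h1 := kp 2 (fun _ => 1) z.
have h2 := kp 2 (fun i => if i == ord0 then 1 else -1) z.
rewrite !big_ord_recl !big_ord0 /= /z /= (ks y x) in h1 h2.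
have := kb x; have := kb y; lra.
Qed.

Section QuadraticForm.
Variables (N : nat) (G : 'I_N -> 'I_N -> R).
Hypothesis G_sym : forall i j, G i j = G j i.

Lemma qformC a b : qform G a b = qform G b a.
Proof.
rewrite /qform exchange_big; apply: eq_bigr => i _; apply: eq_bigr => j _.
by rewrite G_sym (mulrC (a j)).
Qed.

Lemma qformDl (x y : R) a b c :
  qform G (fun i => x * a i + y * b i) c = x * qform G a c + y * qform G b c.
Proof.
rewrite /qform !mulr_sumr -big_split; apply: eq_bigr => i _.
rewrite !mulr_sumr -big_split; apply: eq_bigr => j _ /=; ring.
Qed.

Lemma qformDr (x y : R) a b c :
  qform G c (fun i => x * a i + y * b i) = x * qform G c a + y * qform G c b.
Proof. by rewrite qformC qformDl !(qformC c). Qed.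

Lemma qform_le (b : R) u v : (forall i j, `|G i j| <= b) -> simplex u -> simplex v ->
  `|qform G u v| <= b.
Proof.
move=> Gb [u0 u1] [v0 v1]; apply: (le_trans (ler_norm_sum _ _ _)).
apply: (@le_trans _ _ (\sum_i \sum_j u i * v j * b)).
  apply: ler_sum => i _; apply: (le_trans (ler_norm_sum _ _ _)); apply: ler_sum => j _.
  by rewrite normrM ger0_norm ?mulr_ge0 // ler_wpM2l // mulr_ge0.
under eq_bigr do rewrite -mulr_suml -mulr_sumr v1 mulr1.
by rewrite -mulr_suml u1 mul1r.
Qed.

End QuadraticForm.

Lemma simplex_vertex N (i : 'I_N) : simplex (fun j => (j == i)%:R : R).
Proof.
split=> [j|]; first exact: ler0n.
by rewrite (bigD1 i) //= eqxx big1 ?addr0 // => j /negPf ->.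
Qed.

Lemma sum_vertex N (i : 'I_N) (f : 'I_N -> R) : \sum_j (j == i)%:R * f j = f i.
Proof.
rewrite (bigD1 i) //= eqxx mul1r big1 ?addr0 // => j /negPf ->.
by rewrite mul0r.
Qed.

Lemma simplex_mix N (g : R) (u v : 'I_N -> R) : 0 <= g <= 1 -> simplex u -> simplex v ->
  simplex (fun i => (1 - g) * u i + g * v i).
Proof.
move=> /andP[g0 g1] [u0 u1] [v0 v1]; split=> [i|].
  by rewrite addr_ge0 ?mulr_ge0 ?subr_ge0.
by rewrite big_split /= -!mulr_sumr u1 v1 !mulr1 subrK.
Qed.

Variables (N : nat) (C b : R) (k : X -> X -> R) (xs : 'I_N -> X) (m : 'I_N -> R).
Hypotheses (k_pd : pd_kernel k) (k_le : forall x, k x x <= b).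
Let G i j := k (xs i) (xs j).
Let G_sym i j : G i j = G j i. Proof. by have [h _] := k_pd; exact: h. Qed.
Let G_psd a : 0 <= qform G a a. Proof. by have [_ h] := k_pd; exact: h. Qed.
Let G_le i j : `|G i j| <= b. Proof. exact: pd_kernel_le. Qed.

(** The selected vertex minimizes the linearized risk over the simplex, so it does at least as well
    as the competitor [v]; the curvature term is a squared distance between two simplex embeddings,
    at most [4 * b]. *)
Lemma frank_wolfe_step (w v : 'I_N -> R) (g : R) (it : 'I_N) :
  0 <= g <= 1 -> simplex w -> simplex v ->
  (forall i, \sum_j w j * k (xs j) (xs it) - m it <= \sum_j w j * k (xs j) (xs i) - m i) ->
  risk C k xs m (fun j => (1 - g) * w j + g * (j == it)%:R) <=
    (1 - g) * risk C k xs m w + g * risk C k xs m v + 4 * b * g ^+ 2.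
Proof.
move=> /andP[g0 g1] ws vs itmin; pose d : 'I_N -> R := fun j => (j == it)%:R.
rewrite -[fun j => (1 - g) * _ + _]/(fun j => (1 - g) * w j + g * d j).
have ds : simplex d by exact: simplex_vertex.
rewrite /risk -/G qformDl !qformDr // (qformC _ d w) //.
have -> : \sum_i ((1 - g) * w i + g * d i) * m i =
    (1 - g) * (\sum_i w i * m i) + g * m it.
  rewrite -(sum_vertex it m) !mulr_sumr -big_split; apply: eq_bigr => i _ /=; ring.
have wd : qform G w d = \sum_j w j * k (xs j) (xs it).
  apply: eq_bigr => j _; under eq_bigr do rewrite mulrAC mulrC.
  by rewrite /d sum_vertex.
have wv : qform G w v - \sum_i v i * m i =
    \sum_i v i * (\sum_j w j * k (xs j) (xs i) - m i).
  under [RHS]eq_bigr do rewrite mulrBr mulr_sumr.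
  rewrite sumrB; congr (_ - _); rewrite /qform exchange_big; apply: eq_bigr => i _.
  by apply: eq_bigr => j _ /=; rewrite mulrCA mulrA.
have h1 : qform G w d - m it <= qform G w v - \sum_i v i * m i.
  rewrite wv wd; case: vs => v0 v1; rewrite -[leLHS]mul1r -v1 mulr_suml.
  by apply: ler_sum => i _; rewrite ler_wpM2l.
have h2 := G_psd (fun i => 1 * w i + (-1) * v i).
rewrite qformDl !qformDr // (qformC _ v w) // in h2.
have := qform_le G_le ws ws; have := qform_le G_le ws ds; have := qform_le G_le ds ds.
rewrite !ler_norml => /andP[_ h3] /andP[h4 _] /andP[_ h5].
set Lw := \sum_i w i * m i; set Lv := \sum_i v i * m i in h1 *.
(* The right side minus the left side of the goal is twice the expression in [e1] plus those in [e2]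
   and [e3]: vertex choice, convexity, curvature. *)
have e1 : 0 <= g * (qform G w v - Lv - (qform G w d - m it)) by rewrite mulr_ge0 // subr_ge0.
have e2 : 0 <= g * (qform G w w - 2 * qform G w v + qform G v v).
  by rewrite mulr_ge0 //; lra.
have e3 : 0 <= g ^+ 2 * (4 * b - qform G w w + 2 * qform G w d - qform G d d).
  by rewrite mulr_ge0 ?sqr_ge0 //; lra.
clearbody Lw Lv G; lra.
Qed.

(** Induction on [t]: the base value [16 * b / 2] is the assumed [8 * b], and the step reduces to
    [(t + 1) * (t + 3) <= (t + 2) ^ 2]. *)
Lemma frank_wolfe_rate (v : 'I_N -> R) (W : nat -> 'I_N -> R) (T : nat) :
  simplex v -> fw_run k xs m W T ->
  (forall i, risk C k xs m (fun j => (j == i)%:R) <= risk C k xs m v + 8 * b) ->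
  simplex (W T) /\ risk C k xs m (W T) <= risk C k xs m v + 16 * b / (T%:R + 2).
Proof.
move=> vs [[i0 [_ W0]] step] init.
have b0 : 0 <= b.
  by apply: le_trans (G_le i0 i0).
suff h t : (t <= T)%N ->
    simplex (W t) /\ risk C k xs m (W t) <= risk C k xs m v + 16 * b / (t%:R + 2) by exact: h.
elim: t => [_|t IH tT].
  rewrite W0; split; first exact: simplex_vertex.
  apply: le_trans (init i0) _; rewrite lerD2l add0r; lra.
have [Ws Wr] := IH (ltnW tT).
have [it [itmin ->]] := step t tT; move=> {step IH}.
have t0 : 0 <= t%:R :> R by exact: ler0n.
have t2 : 0 < t%:R + 2 :> R by lra.
set g := 2 / (t%:R + 2).
have g01 : 0 <= g <= 1.
  by apply/andP; split; rewrite /g ?divr_ge0 ?ler_pdivrMr ?mul1r ?lerDr // ltW.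
split; first exact: simplex_mix Ws (simplex_vertex it).
apply: le_trans (frank_wolfe_step g01 Ws vs itmin) _.
case/andP: g01 => g0 g1.
apply: (@le_trans _ _ (risk C k xs m v + ((1 - g) * (16 * b / (t%:R + 2)) + 4 * b * g ^+ 2))).
  have : (1 - g) * risk C k xs m (W t) <=
      (1 - g) * (risk C k xs m v + 16 * b / (t%:R + 2)) by rewrite ler_wpM2l ?subr_ge0.
  lra.
rewrite lerD2l.
have -> : (1 - g) * (16 * b / (t%:R + 2)) + 4 * b * g ^+ 2 =
    16 * b * ((t%:R + 1) / (t%:R + 2) ^+ 2) by rewrite /g; field; rewrite gt_eqF.
have -> : t.+1%:R + 2 = t%:R + 3 :> R by rewrite -natr1; ring.
apply: ler_wpM2l; first by rewrite mulr_ge0.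
have t3 : 0 < t%:R + 3 :> R by lra.
rewrite ler_pdivrMr ?exprn_gt0 // mulrC ler_pdivlMr //; nra.
Qed.

End FrankWolfe.

Lemma exists_invS_lt (R : realType) (e : R) : 0 < e -> exists M : nat, M.+1%:R^-1 < e.
Proof.
move=> e0; exists (Num.truncn e^-1).
by rewrite invf_plt ?posrE ?ltr0n // truncnS_gt.
Qed.

(** * Hilbert space facts drawn from [is_rkhs], up to density of kernel combinations *)

Section ReproducingKernelHilbertSpace.
Variables (R : realType) (X : Type) (k : X -> X -> R).
Variables (H : set (X -> R)) (ip : (X -> R) -> (X -> R) -> R).
Hypothesis rkhs : is_rkhs k H ip.

Let H0 : H (fun _ => 0). Proof. by case: rkhs. Qed.
Let HD a f g : H f -> H g -> H (fun x => a * f x + g x).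
Proof. by have [_ [h _]] := rkhs; exact: h. Qed.
Let ipC f g : H f -> H g -> ip f g = ip g f.
Proof. by have [_ [_ [h _]]] := rkhs; exact: h. Qed.
Let ipDl a f g h : H f -> H g -> H h -> ip (fun x => a * f x + g x) h = a * ip f h + ip g h.
Proof. by have [_ [_ [_ [P _]]]] := rkhs; exact: P. Qed.
Let ip_ge0 f : H f -> 0 <= ip f f.
Proof. by have [_ [_ [_ [_ [P _]]]]] := rkhs => /P[]. Qed.
Let Hk x : H (k x).
Proof. by have [_ [_ [_ [_ [_ [_ [P _]]]]]]] := rkhs; exact: P. Qed.
Let ipk f x : H f -> ip f (k x) = f x.
Proof. by have [_ [_ [_ [_ [_ [_ [_ P]]]]]]] := rkhs; exact: P. Qed.

Lemma rkhs_sub f g : H f -> H g -> H (fun x => f x - g x).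
Proof.
move=> Hf Hg; have -> : (fun x => f x - g x) = (fun x => -1 * g x + f x).
  by apply/funext => x; rewrite mulN1r addrC.
exact: HD.
Qed.

Lemma rkhs_ip_lin (a : R) f g : H f -> H g ->
  ip (fun x => a * f x + g x) (fun x => a * f x + g x) =
  a ^+ 2 * ip f f + 2 * a * ip f g + ip g g.
Proof.
move=> Hf Hg; have Hh := HD a Hf Hg.
rewrite ipDl // (ipC Hf Hh) (ipC Hg Hh) !ipDl // (ipC Hg Hf); ring.
Qed.

Lemma rkhs_ip_sub f g : H f -> H g ->
  ip (fun x => f x - g x) (fun x => f x - g x) = ip f f - 2 * ip f g + ip g g.
Proof.
move=> Hf Hg; have -> : (fun x => f x - g x) = (fun x => -1 * g x + f x).
  by apply/funext => x; rewrite mulN1r addrC.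
rewrite rkhs_ip_lin // (ipC Hg Hf); ring.
Qed.

Lemma rkhs_cauchy_schwarz f g : H f -> H g -> ip f g ^+ 2 <= ip f f * ip g g.
Proof.
move=> Hf Hg; have f0 := ip_ge0 Hf; have g0 := ip_ge0 Hg.
have h a := ip_ge0 (HD a Hf Hg).
have {}h a : 0 <= a ^+ 2 * ip f f + 2 * a * ip f g + ip g g by rewrite -rkhs_ip_lin // h.
exact: quadratic_ge0_discr.
Qed.

Lemma rkhs_eval_le f x : H f -> f x ^+ 2 <= ip f f * k x x.
Proof.
move=> Hf; have := rkhs_cauchy_schwarz Hf (Hk x).
by rewrite ipk // (ipk _ (Hk x)).
Qed.

(** Pairs of a coefficient and a point, repetitions allowed, so that linear combinations become
    concatenations of lists. *)
Definition kcomb (s : seq (R * X)) : X -> R := fun x => \sum_(a <- s) a.1 * k a.2 x.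

Lemma kcomb_rkhs s : H (kcomb s).
Proof.
elim: s => [|a s IH].
  by have -> : kcomb [::] = (fun _ => 0) by apply/funext => x; rewrite /kcomb big_nil.
have -> : kcomb (a :: s) = (fun x => a.1 * k a.2 x + kcomb s x).
  by apply/funext => x; rewrite /kcomb big_cons.
exact: HD.
Qed.

Lemma kcomb_lin (a c : R) s t : kcomb ([seq (a * b.1, b.2) | b <- s] ++
    [seq (c * b.1, b.2) | b <- t]) = (fun x => a * kcomb s x + c * kcomb t x).
Proof.
apply/funext => x; rewrite /kcomb big_cat !big_map !mulr_sumr.
by congr (_ + _); apply: eq_bigr => b _ /=; rewrite mulrA.
Qed.

Lemma ip_kcomb s f : H f -> ip (kcomb s) f = \sum_(a <- s) a.1 * f a.2.
Proof.
move=> Hf; elim: s => [|a s IH].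
  rewrite big_nil; have -> : kcomb [::] = (fun x => (-1) * f x + f x).
    by apply/funext => x; rewrite /kcomb big_nil mulN1r addNr.
  by rewrite ipDl // mulN1r addNr.
have -> : kcomb (a :: s) = (fun x => a.1 * k a.2 x + kcomb s x).
  by apply/funext => x; rewrite /kcomb big_cons.
by rewrite ipDl //; [rewrite big_cons IH ipC // ipk|exact: kcomb_rkhs].
Qed.

(* A sequence of kernel combinations minimizing the distance to [f] is Cauchy; its limit [g]
   satisfies [g x = f x] because moving along [k x] cannot decrease the distance. *)
Lemma kcomb_dense f (eta : R) : H f -> 0 < eta ->
  exists s, ip (fun x => f x - kcomb s x) (fun x => f x - kcomb s x) < eta.
Proof.
move=> Hf eta0.
pose E s := ip (fun x => f x - kcomb s x) (fun x => f x - kcomb s x).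
have E0 s : 0 <= E s by apply/ip_ge0/rkhs_sub => //; exact: kcomb_rkhs.
have hinf : has_inf (range E).
  by split; [exists (E [::]); exists [::]|exists 0 => _ [s _ <-]].
pose d := inf (range E).
have dE s : d <= E s by apply: ge_inf; [case: hinf|exists s].
have vP n : exists s, E s < d + n.+1%:R^-1.
  have n0 : 0 < n.+1%:R^-1 :> R by rewrite invr_gt0.
  by have [_ [s _ <-] h] := inf_adherent n0 hinf; exists s.
have [v vE] := choice vP.
pose u n := kcomb (v n).
have Hu n : H (u n) by exact: kcomb_rkhs.
have [g [Hg ug]] : exists g, H g /\ forall e : R, 0 < e -> exists M : nat,
    forall n, (M <= n)%N -> ip (fun x => u n x - g x) (fun x => u n x - g x) < e.
  have [_ [_ [_ [_ [_ [compl _]]]]]] := rkhs; apply: compl => // e e0.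
  have [M Me] := exists_invS_lt (divr_gt0 e0 (ltr0n R 4)).
  exists M => m n Mm Mn.
  have ME l : (M <= l)%N -> E (v l) < d + e / 4.
    move=> Ml; apply: lt_trans (vE l) _; rewrite ltrD2l; apply: le_lt_trans Me.
    by rewrite lef_pV2 ?posrE ?ltr0n // ler_nat ltnS.
  set D := fun x => u m x - u n x; have HDD : H D by exact: rkhs_sub.
  set F := fun x => f x - u m x; have HF : H F by exact: rkhs_sub.
  (* [w] is the midpoint of [u m] and [u n]. By the parallelogram law the squared norm of [D] is
     [2 E(v m) + 2 E(v n) - 4 E(w)], hence below [e]. *)
  pose w := [seq (2^-1 * b.1, b.2) | b <- v m] ++ [seq (2^-1 * b.1, b.2) | b <- v n].
  have Ew : E w = ip (fun x => 2^-1 * D x + F x) (fun x => 2^-1 * D x + F x).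
    rewrite /E kcomb_lin -/(u m) -/(u n).
    by have -> : (fun x => f x - (2^-1 * u m x + 2^-1 * u n x)) =
      (fun x => 2^-1 * D x + F x) by apply/funext => x; rewrite /D /F; field.
  have En : E (v n) = ip (fun x => 1 * D x + F x) (fun x => 1 * D x + F x).
    rewrite /E -/(u n).
    by have -> : (fun x => f x - u n x) =
      (fun x => 1 * D x + F x) by apply/funext => x; rewrite /D /F; ring.
  have Em : E (v m) = ip F F by [].
  have := dE w; have := ME n Mn; have := ME m Mm.
  rewrite Ew En Em !rkhs_ip_lin //; lra.
have fg x : f x = g x.
  apply/eqP; rewrite -subr_eq0; apply/negPn/negP => fg0.
  set dl := f x - g x in fg0; set K := k x x.
  have K0 : 0 <= K by rewrite /K -(ipk x (Hk x)); exact: ip_ge0.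
  have dl2 : 0 < dl ^+ 2 by rewrite lt_def sqr_ge0 sqrf_eq0 fg0.
  (* Shifting [u n] by [s * dl] along [k x] lowers the squared distance to [f] by at least
     [7/8 - 1/2] times [s * dl ^+ 2], whereas the excess over the infimum is below 1/8 of that. The
     7/8 comes from the error [q] of [u n x] against [g x], whose square is at most
     [dl ^+ 2 / 8]. *)
  pose s := (2 * (K + 1))^-1.
  have s0 : 0 < s by rewrite invr_gt0; lra.
  have sK : s * K <= 2^-1.
    by rewrite /s mulrC ler_pdivrMr; lra.
  have e0 : 0 < s * dl ^+ 2 / 8 by rewrite divr_gt0 // mulr_gt0.
  have [M1 hM1] := exists_invS_lt e0.
  have e1 : 0 < dl ^+ 2 / (8 * (K + 1)) by rewrite divr_gt0 // mulr_gt0 //; lra.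
  have [M2 hM2] := ug _ e1.
  pose n := maxn M1 M2; have {hM2}hn := hM2 n (leq_maxr _ _).
  have {hM1}n1 : n.+1%:R^-1 < s * dl ^+ 2 / 8.
    by apply: le_lt_trans hM1; rewrite lef_pV2 ?posrE ?ltr0n // ler_nat ltnS leq_maxl.
  set q := u n x - g x; set r := f x - u n x.
  have q2 : q ^+ 2 <= dl ^+ 2 / 8.
    apply: le_trans (rkhs_eval_le x (rkhs_sub (Hu n) Hg)) _.
    apply: (@le_trans _ _ (dl ^+ 2 / (8 * (K + 1)) * (K + 1))).
      by apply: ler_pM; [exact/ip_ge0/rkhs_sub|exact: K0|exact: ltW|rewrite -/K; lra].
    by rewrite le_eqVlt; apply/orP; left; apply/eqP; field; rewrite gt_eqF //; lra.
  pose F := fun y => f y - u n y; have HF : H F by exact: rkhs_sub.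
  pose t := s * dl.
  have Et : E ([seq (1 * b.1, b.2) | b <- v n] ++ [seq (1 * b.1, b.2) | b <- [:: (t, x)]]) =
      ip (fun y => - t * k x y + F y) (fun y => - t * k x y + F y).
    rewrite /E kcomb_lin -/(u n).
    have -> // : (fun y => f y - (1 * u n y + 1 * kcomb [:: (t, x)] y)) =
      (fun y => - t * k x y + F y).
    by apply/funext => y; rewrite /kcomb big_seq1 /F /=; ring.
  have := dE ([seq (1 * b.1, b.2) | b <- v n] ++ [seq (1 * b.1, b.2) | b <- [:: (t, x)]]).
  rewrite Et rkhs_ip_lin // (ipC (Hk x) HF) !ipk // -/K -/r.
  have := vE n; rewrite /E -/(u n) -/F => h1 h2.
  have rE : r = dl - q by rewrite /r /dl /q; ring.
  have h3 : 2 * t * r <= t ^+ 2 * K + n.+1%:R^-1.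
    move: h1 h2; rewrite -[F x]/r sqrrN mulrN mulNr.
    by move: (n.+1%:R^-1) (ip F F) (t ^+ 2 * K) (2 * t * r) => *; lra.
  have h4 : t ^+ 2 * K <= s * dl ^+ 2 * 2^-1.
    have -> : t ^+ 2 * K = s * dl ^+ 2 * (s * K) by rewrite /t; ring.
    by rewrite ler_wpM2l // mulr_ge0 // ltW.
  have h5 : s * (dl ^+ 2 - q ^+ 2) <= 2 * t * r.
    rewrite rE /t -subr_ge0.
    have -> : 2 * (s * dl) * (dl - q) - s * (dl ^+ 2 - q ^+ 2) = s * (dl - q) ^+ 2 by ring.
    by rewrite mulr_ge0 ?sqr_ge0 // ltW.
  have h6 : s * q ^+ 2 <= s * (dl ^+ 2 / 8) by rewrite ler_wpM2l // ltW.
  have h7 : 0 < s * dl ^+ 2 by rewrite mulr_gt0.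
  move: n1 h3 h4 h5 h6 h7; rewrite (mulrBr s) (mulrA s _ 8^-1).
  move: (n.+1%:R^-1) (t ^+ 2 * K) (2 * t * r) (s * dl ^+ 2) (s * q ^+ 2) => *; lra.
have {}fg : f = g by apply/funext.
have [M uM] := ug _ eta0; exists (v M); rewrite -fg in uM.
have := uM M (leqnn M); rewrite -[kcomb (v M)]/(u M) rkhs_ip_sub // => h.
by rewrite rkhs_ip_sub // (ipC Hf (Hu M)); lra.
Qed.

End ReproducingKernelHilbertSpace.

(** * Integrals through the Mercer expansion, and the risk as a weighted sequence norm *)

Section Mercer.
Variables (R : realType) (dX : measure_display) (X : measurableType dX).
Variables (mu : probability X R) (k : X -> X -> R) (sigma : nat -> R) (e : nat -> X -> R).
Variable b : R.

Lemma cvg_sumr (I : Type) (r : seq I) (u : I -> nat -> R) (l : I -> R) :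
  (forall i, u i @ \oo --> l i) -> (fun n => \sum_(i <- r) u i n) @ \oo --> \sum_(i <- r) l i.
Proof. by move=> ul; apply: cvg_big => [|i _]; [exact: add_continuous|exact: ul]. Qed.

Lemma cvgn_le (u : nat -> R) (l c : R) (M : nat) :
  u @ \oo --> l -> (forall n, (M <= n)%N -> u n <= c) -> l <= c.
Proof.
move=> ul uc; apply: (@closed_cvg _ _ _ _ u (fun y => y <= c) (@closed_le R c) _ l ul).
by exists M.
Qed.

Lemma cvgn_ge (u : nat -> R) (l c : R) (M : nat) :
  u @ \oo --> l -> (forall n, (M <= n)%N -> c <= u n) -> c <= l.
Proof.
move=> ul uc; apply: (@closed_cvg _ _ _ _ u (fun y => c <= y) (@closed_ge R c) _ l ul).
by exists M.
Qed.

Lemma bounded_integrable (f : X -> R) (c : R) :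
  measurable_fun setT f -> (forall x, `|f x| <= c) -> mu.-integrable setT (EFin \o f).
Proof.
move=> mf fc; apply: (@le_integrable _ _ _ mu setT measurableT _ (EFin \o cst c)).
- exact/measurable_EFinP.
- by move=> x _ /=; rewrite lee_fin (le_trans (fc x)) // ler_norm.
- exact: finite_measure_integrable_cst.
Qed.

Lemma Rintegral_cstT (c : R) : \int[mu]_x c = c.
Proof.
transitivity (c * fine (mu setT)); first exact: (Rintegral_cst mu measurableT c).
by rewrite probability_setT mulr1.
Qed.

Lemma Rintegral_sumr (I : Type) (r : seq I) (f : I -> X -> R) :
  (forall i, mu.-integrable setT (EFin \o f i)) ->
  \int[mu]_x (\sum_(i <- r) f i x) = \sum_(i <- r) \int[mu]_x f i x.
Proof.
move=> fi; rewrite /Rintegral; under eq_integral do rewrite -sumEFin.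
rewrite integral_sum // sum_fine // => i _.
exact: (integral_fune_fin_num _ (fi i)).
Qed.

Lemma integrable_sumr (I : Type) (r : seq I) (f : I -> X -> R) :
  (forall i, mu.-integrable setT (EFin \o f i)) ->
  mu.-integrable setT (EFin \o (fun x => \sum_(i <- r) f i x)).
Proof.
move=> fi; have -> : EFin \o (fun x => \sum_(i <- r) f i x) =
    (fun x => \sum_(i <- r) (EFin \o f i) x)%E by apply/funext => x; rewrite /= -sumEFin.
by apply: integrable_sum => // i _; exact: fi.
Qed.

Lemma integrable_add (f g : X -> R) : mu.-integrable setT (EFin \o f) ->
  mu.-integrable setT (EFin \o g) -> mu.-integrable setT (EFin \o (fun x => f x + g x)).
Proof.
move=> fi gi; have -> : EFin \o (fun x => f x + g x) = ((EFin \o f) \+ (EFin \o g))%E.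
  by apply/funext => x; rewrite /= EFinD.
exact: integrableD.
Qed.

Lemma integrable_scale (c : R) (f : X -> R) :
  mu.-integrable setT (EFin \o f) -> mu.-integrable setT (EFin \o (fun x => c * f x)).
Proof.
move=> fi; have -> : EFin \o (fun x => c * f x) = (fun x => c%:E * (EFin \o f) x)%E.
  by apply/funext => x; rewrite /= EFinM.
exact: integrableZl.
Qed.

Lemma dominated_cvg_Rintegral (f_ : nat -> X -> R) (f : X -> R) (c : R) :
  (forall n, measurable_fun setT (f_ n)) ->
  (forall x, (fun n => f_ n x) @ \oo --> f x) ->
  (forall n x, `|f_ n x| <= c) ->
  (fun n => \int[mu]_x f_ n x) @ \oo --> \int[mu]_x f x.
Proof.
move=> mf ff fc.
have mf' : measurable_fun setT f by apply: measurable_fun_cvg mf _ => x _; exact: ff.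
have fc' x : `|f x| <= c.
  rewrite ler_norml; apply/andP; split.
    by apply: (cvgn_ge (M := 0) (ff x)) => n _; have := fc n x; rewrite ler_norml => /andP[].
  by apply: (cvgn_le (M := 0) (ff x)) => n _; have := fc n x; rewrite ler_norml => /andP[].
apply: fine_cvg; rewrite fineK; last first.
  exact: (integral_fune_fin_num _ (bounded_integrable mf' fc')).
apply: (@dominated_cvg _ _ _ mu setT measurableT _ _ (EFin \o cst c)) => //.
- by move=> n; exact/measurable_EFinP.
- by move=> x _; apply: cvg_EFin; [exact: nearW|exact: ff].
- exact: finite_measure_integrable_cst.
- by move=> n x _ /=; rewrite lee_fin.
Qed.

Hypotheses (e_on : orthonormal_L2 mu e) (sigma_ge0 : forall j, 0 <= sigma j).
Hypothesis mercer :
  forall x y, (fun n => \sum_(0 <= j < n) sigma j * e j x * e j y) @ \oo --> k x y.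
Arguments mercer : clear implicits.
Hypothesis k_le : forall x, k x x <= b.

Lemma e_measurable j : measurable_fun setT (e j).
Proof. by case: e_on. Qed.

(** Measurability passes from the Mercer partial sums to their pointwise limit. *)
Lemma kernel_measurable y : measurable_fun setT (k^~ y).
Proof.
apply: (@measurable_fun_cvg _ _ _ setT
  (fun n x => \sum_(0 <= j < n) sigma j * e j x * e j y)) => // n.
apply: measurable_sum => j; apply: measurable_funM => //.
by apply: measurable_funM => //; exact: e_measurable.
Qed.

Lemma kernel_diag_measurable : measurable_fun setT (fun x => k x x).
Proof.
apply: (@measurable_fun_cvg _ _ _ setT
  (fun n x => \sum_(0 <= j < n) sigma j * e j x * e j x)) => // n.
apply: measurable_sum => j; apply: measurable_funM; last exact: e_measurable.
by apply: measurable_funM => //; exact: e_measurable.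
Qed.

Lemma mercer_partial_le n x : \sum_(0 <= j < n) sigma j * e j x ^+ 2 <= k x x.
Proof.
apply: (cvgn_ge (M := n) (mercer x x)) => m nm.
rewrite [leRHS](big_cat_nat (leq0n n) nm) /=.
under [X in _ <= X + _]eq_bigr do rewrite -mulrA -expr2.
rewrite lerDl sumr_ge0 // => j _.
by rewrite -mulrA -expr2 mulr_ge0 // sqr_ge0.
Qed.

(** Cauchy-Schwarz between two partial diagonals, each at most [b]. This uniform bound is the
    dominating constant for integrating the expansion term by term. *)
Lemma mercer_cross_le n x y : `|\sum_(0 <= j < n) sigma j * e j x * e j y| <= b.
Proof.
have [b0 xb yb] : [/\ 0 <= b, \sum_(0 <= j < n) sigma j * e j x ^+ 2 <= b &
                   \sum_(0 <= j < n) sigma j * e j y ^+ 2 <= b].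
  split; rewrite ?(le_trans (mercer_partial_le _ _)) //.
  apply: le_trans (k_le x); apply: le_trans (mercer_partial_le 0 x).
  by rewrite big_geq.
rewrite -(ler_pXn2r (ltn0Sn 1)) ?nnegrE // real_normK ?num_real //.
apply: le_trans (weighted_cauchy_schwarz _ _ _ sigma_ge0) _; rewrite expr2.
by apply: ler_pM => //; apply: sumr_ge0 => j _; rewrite mulr_ge0 // sqr_ge0.
Qed.

Lemma e_sq_integrable j : mu.-integrable setT (EFin \o (fun x => e j x ^+ 2)).
Proof.
apply/integrableP; split.
  by apply/measurable_EFinP; apply: measurable_funX; exact: e_measurable.
have [_ /(_ j j)] := e_on; rewrite eqxx => h.
have -> : (\int[mu]_x `|(EFin \o (fun x => (e j x ^+ 2)%R)) x|)%E =
    (\int[mu]_x (e j x * e j x)%:E)%E; last by rewrite h ltry.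
by apply: eq_integral => x _ /=; rewrite ger0_norm ?sqr_ge0 // expr2.
Qed.

Lemma e_sq_integral j : \int[mu]_x (e j x ^+ 2) = 1.
Proof.
have [_ /(_ j j)] := e_on; rewrite eqxx /Rintegral => h.
by under eq_integral do rewrite expr2; rewrite h.
Qed.

Lemma e_integrable j : mu.-integrable setT (EFin \o e j).
Proof.
apply: (@le_integrable _ _ _ mu setT measurableT _ (EFin \o (fun x => 1 + e j x ^+ 2))).
- exact/measurable_EFinP/e_measurable.
- move=> x _ /=; rewrite lee_fin [leRHS]ger0_norm ?addr_ge0 ?sqr_ge0 //.
  by rewrite ler_norml; have := sqr_ge0 (e j x - 1); have := sqr_ge0 (e j x + 1); lra.
- apply: integrable_add; last exact: e_sq_integrable.
  exact: (finite_measure_integrable_cst _ _ measurableT).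
Qed.

(** Nonnegativity of the variance. *)
Lemma Rintegral_sq_le (f : X -> R) : mu.-integrable setT (EFin \o f) ->
  mu.-integrable setT (EFin \o (fun x => f x ^+ 2)) ->
  (\int[mu]_x f x) ^+ 2 <= \int[mu]_x (f x ^+ 2).
Proof.
move=> fi f2i; set m := \int[mu]_x f x.
have ci c : mu.-integrable setT (EFin \o (fun _ : X => c)).
  exact: (finite_measure_integrable_cst _ _ measurableT).
have h : 0 <= \int[mu]_x ((f x ^+ 2 + (- 2 * m) * f x) + m ^+ 2).
  apply: Rintegral_ge0 => x _.
  have -> : f x ^+ 2 + - 2 * m * f x + m ^+ 2 = (f x - m) ^+ 2 by ring.
  exact: sqr_ge0.
move: h; rewrite !RintegralD ?RintegralZl ?Rintegral_cstT -/m //; first lra.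
- exact: integrable_scale.
- by apply: integrable_add => //; exact: integrable_scale.
Qed.

Definition emean j := \int[mu]_x e j x.

Lemma emean_sq_le1 j : emean j ^+ 2 <= 1.
Proof.
rewrite -(e_sq_integral j); apply: Rintegral_sq_le; first exact: e_integrable.
exact: e_sq_integrable.
Qed.

Lemma kme_mercer z : (fun n => \sum_(0 <= j < n) sigma j * emean j * e j z) @ \oo --> kme mu k z.
Proof.
have := @dominated_cvg_Rintegral (fun n x => \sum_(0 <= j < n) sigma j * e j x * e j z)
  (k^~ z) b _ (fun x => mercer x z) (fun n x => mercer_cross_le n x z).
have -> : (fun n => \int[mu]_x (\sum_(0 <= j < n) sigma j * e j x * e j z)) =
    (fun n => \sum_(0 <= j < n) sigma j * emean j * e j z).
  apply/funext => n; rewrite Rintegral_sumr => [|j].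
    apply: eq_bigr => j _; under eq_Rintegral do rewrite mulrAC.
    by rewrite RintegralZl //; [rewrite mulrAC|exact: e_integrable].
  have -> : (fun x => sigma j * e j x * e j z) = (fun x => (sigma j * e j z) * e j x).
    by apply/funext => x; rewrite mulrAC.
  exact/integrable_scale/e_integrable.
apply=> n; apply: measurable_sum => j; apply: measurable_funM => //.
by apply: measurable_funM => //; exact: e_measurable.
Qed.

Arguments kme_mercer : clear implicits.

(** The diagonal expansion is integrated by dominated convergence; each [e j] has unit second
    moment. *)
Lemma kernel_trace : (fun n => \sum_(0 <= j < n) sigma j) @ \oo --> \int[mu]_x k x x.
Proof.
have := @dominated_cvg_Rintegral (fun n x => \sum_(0 <= j < n) sigma j * e j x * e j x)
  (fun x => k x x) b _ (fun x => mercer x x) (fun n x => mercer_cross_le n x x).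
have -> : (fun n => \int[mu]_x (\sum_(0 <= j < n) sigma j * e j x * e j x)) =
    (fun n => \sum_(0 <= j < n) sigma j).
  apply/funext => n; have E j : (fun x => sigma j * e j x * e j x) =
      (fun x => sigma j * e j x ^+ 2) by apply/funext => x; rewrite expr2 mulrA.
  rewrite Rintegral_sumr => [|j].
    apply: eq_bigr => j _; rewrite E RintegralZl ?e_sq_integral ?mulr1 //.
    exact: e_sq_integrable.
  by rewrite E; exact/integrable_scale/e_sq_integrable.
apply=> n; apply: measurable_sum => j; apply: measurable_funM; last exact: e_measurable.
by apply: measurable_funM => //; exact: e_measurable.
Qed.

Lemma kernel_abs_le x y : `|k x y| <= b.
Proof.
have h n := mercer_cross_le n x y; rewrite ler_norml; apply/andP; split.
  by apply: (cvgn_ge (M := 0) (mercer x y)) => n _; have := h n; rewrite ler_norml => /andP[].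
by apply: (cvgn_le (M := 0) (mercer x y)) => n _; have := h n; rewrite ler_norml => /andP[].
Qed.

Lemma kernel_diag_integrable : mu.-integrable setT (EFin \o (fun x => k x x)).
Proof. exact: bounded_integrable kernel_diag_measurable (fun x => kernel_abs_le x x). Qed.

Lemma Rintegral_abs_le (f : X -> R) (c : R) : measurable_fun setT f ->
  (forall x, `|f x| <= c) -> `|\int[mu]_x f x| <= c.
Proof.
move=> mf fc; have fi := bounded_integrable mf fc.
have ci a : mu.-integrable setT (EFin \o (fun _ : X => a)).
  exact: (finite_measure_integrable_cst _ _ measurableT).
rewrite ler_norml -[X in X <= _ <= _]Rintegral_cstT -[X in _ <= _ <= X]Rintegral_cstT.
by apply/andP; split; apply: le_Rintegral => // x _; have := fc x; rewrite ler_norml => /andP[].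
Qed.

Lemma trace_le : \int[mu]_x k x x <= b.
Proof.
apply: le_trans (ler_norm _) _; apply: Rintegral_abs_le => [|x]; last exact: kernel_abs_le.
exact: kernel_diag_measurable.
Qed.

Lemma kme_abs_le z : `|kme mu k z| <= b.
Proof.
exact: (@Rintegral_abs_le (k^~ z) b (kernel_measurable z) (fun x => kernel_abs_le x z)).
Qed.

Lemma sum_sigma_le_trace n : \sum_(0 <= j < n) sigma j <= \int[mu]_x k x x.
Proof.
apply: (cvgn_ge (M := n) kernel_trace) => m nm.
by rewrite [leRHS](big_cat_nat (leq0n n) nm) /= lerDl sumr_ge0.
Qed.

(** The squared RKHS norm of the mean embedding, written in Mercer coefficients so that its
    membership in [H] never has to be established. *)
Definition embed_sq : R := limn (fun n => \sum_(0 <= j < n) sigma j * emean j ^+ 2).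

Lemma sum_emean_le (r : seq nat) :
  \sum_(j <- r) sigma j * emean j ^+ 2 <= \sum_(j <- r) sigma j.
Proof.
apply: ler_sum => j _; rewrite -[leRHS]mulr1.
by rewrite ler_wpM2l // emean_sq_le1.
Qed.

Lemma embed_sq_cvg : (fun n => \sum_(0 <= j < n) sigma j * emean j ^+ 2) @ \oo --> embed_sq.
Proof.
apply: nondecreasing_is_cvgn.
  move=> n m nm; rewrite [leRHS](big_cat_nat (leq0n n) nm) /= lerDl.
  by apply: sumr_ge0 => j _; rewrite mulr_ge0 // sqr_ge0.
exists (\int[mu]_x k x x) => _ [n _ <-].
exact: le_trans (sum_emean_le _) (sum_sigma_le_trace n).
Qed.

Lemma embed_sq_le : embed_sq <= b.
Proof.
apply: (cvgn_le (M := 0) embed_sq_cvg) => n _.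
exact: le_trans (sum_emean_le _) (le_trans (sum_sigma_le_trace n) trace_le).
Qed.

Section Weights.
Variables (N : nat) (xs : 'I_N -> X) (w : 'I_N -> R).

(** Stated for an arbitrary index list: initial segments give the limit [risk], segments from [dd]
    on the tail estimate. *)
Lemma weighted_sq_expand (r : seq nat) :
  \sum_(j <- r) sigma j * (emean j - \sum_i w i * e j (xs i)) ^+ 2 =
  \sum_(j <- r) sigma j * emean j ^+ 2
  - 2 * (\sum_i w i * \sum_(j <- r) sigma j * emean j * e j (xs i))
  + qform (fun i l => \sum_(j <- r) sigma j * e j (xs i) * e j (xs l)) w w.
Proof.
have -> : \sum_i w i * \sum_(j <- r) sigma j * emean j * e j (xs i) =
    \sum_(j <- r) sigma j * emean j * \sum_i w i * e j (xs i).
  under eq_bigr do rewrite mulr_sumr; rewrite exchange_big; apply: eq_bigr => j _ /=.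
  by rewrite mulr_sumr; apply: eq_bigr => i _; rewrite mulrCA.
have -> : qform (fun i l => \sum_(j <- r) sigma j * e j (xs i) * e j (xs l)) w w =
    \sum_(j <- r) sigma j * (\sum_i w i * e j (xs i)) ^+ 2.
  rewrite /qform; under eq_bigr do under eq_bigr do rewrite mulr_sumr.
  under eq_bigr do rewrite exchange_big /=.
  rewrite exchange_big; apply: eq_bigr => j _ /=; rewrite expr2 mulr_suml mulr_sumr.
  apply: eq_bigr => i _; rewrite !mulr_sumr; apply: eq_bigr => l _; ring.
rewrite mulr_sumr -sumrB -big_split; apply: eq_bigr => j _ /=; ring.
Qed.

Let m i := kme mu k (xs i).

Lemma risk_cvg :
  (fun n => \sum_(0 <= j < n) sigma j * (emean j - \sum_i w i * e j (xs i)) ^+ 2) @ \oo -->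
  risk embed_sq k xs m w.
Proof.
under eq_fun do rewrite weighted_sq_expand.
apply: cvgD; first (apply: cvgB; first exact: embed_sq_cvg).
  apply: cvgMr; apply: cvg_sumr => i; apply: cvgMr; exact: kme_mercer.
apply: cvg_sumr => i; apply: cvg_sumr => l; apply: cvgMr; exact: mercer.
Qed.

Lemma risk_ge0 : 0 <= risk embed_sq k xs m w.
Proof.
apply: (cvgn_ge (M := 0) risk_cvg) => n _.
by apply: sumr_ge0 => j _; rewrite mulr_ge0 // sqr_ge0.
Qed.

(** The squared embedding norm and the quadratic form cost [b] each, the cross term [2 * b]. *)
Lemma risk_le : simplex w -> risk embed_sq k xs m w <= 4 * b.
Proof.
move=> ws; have := qform_le (fun i j => kernel_abs_le (xs i) (xs j)) ws ws.
rewrite ler_norml => /andP[_ h1]; have h2 := embed_sq_le.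
have h3 : - b <= \sum_i w i * m i.
  case: ws => w0 w1; rewrite -[leLHS]mul1r -w1 mulr_suml; apply: ler_sum => i _.
  by rewrite ler_wpM2l //; have := kme_abs_le (xs i); rewrite ler_norml => /andP[].
rewrite /risk; lra.
Qed.

(* Cauchy-Schwarz in the sequence space of Mercer coefficients. *)
Lemma kcomb_quadrature_sq (s : seq (R * X)) :
  (\sum_(a <- s) a.1 * (kme mu k a.2 - \sum_i w i * k (xs i) a.2)) ^+ 2 <=
  (\sum_(a <- s) a.1 * \sum_(c <- s) c.1 * k c.2 a.2) * risk embed_sq k xs m w.
Proof.
(* [V] and [d] hold the Mercer coordinates of the combination and of the embedding error. Their
   [sigma]-weighted pairing tends to the quadrature error, their weighted squares to the two factors
   on the right. *)
pose V j := \sum_(a <- s) a.1 * e j a.2.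
pose d j := emean j - \sum_i w i * e j (xs i).
have c1 : (fun n => \sum_(0 <= j < n) sigma j * V j * d j) @ \oo -->
    \sum_(a <- s) a.1 * (kme mu k a.2 - \sum_i w i * k (xs i) a.2).
  have -> : (fun n => \sum_(0 <= j < n) sigma j * V j * d j) =
      (fun n => \sum_(a <- s) a.1 * (\sum_(0 <= j < n) sigma j * emean j * e j a.2 -
         \sum_i w i * \sum_(0 <= j < n) sigma j * e j (xs i) * e j a.2)).
    apply/funext => n.
    transitivity (\sum_(0 <= j < n) \sum_(a <- s) a.1 * (sigma j * e j a.2 * d j)).
      apply: eq_bigr => j _; rewrite /V mulr_sumr mulr_suml; apply: eq_bigr => a _; ring.
    rewrite exchange_big; apply: eq_bigr => a _ /=; rewrite -mulr_sumr; congr (_ * _).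
    have -> : \sum_i w i * \sum_(0 <= j < n) sigma j * e j (xs i) * e j a.2 =
        \sum_(0 <= j < n) \sum_i w i * (sigma j * e j (xs i) * e j a.2).
      by rewrite exchange_big; apply: eq_bigr => i _ /=; rewrite mulr_sumr.
    rewrite -sumrB; apply: eq_bigr => j _; rewrite /d mulrBr mulr_sumr; congr (_ - _).
      ring.
    apply: eq_bigr => i _; ring.
  apply: cvg_sumr => a; apply: cvgMr; apply: cvgB; first exact: kme_mercer.
  apply: cvg_sumr => i; apply: cvgMr; exact: mercer.
have c2 : (fun n => \sum_(0 <= j < n) sigma j * V j ^+ 2) @ \oo -->
    \sum_(a <- s) a.1 * \sum_(c <- s) c.1 * k c.2 a.2.
  have -> : (fun n => \sum_(0 <= j < n) sigma j * V j ^+ 2) =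
      (fun n => \sum_(a <- s) a.1 *
         \sum_(c <- s) c.1 * \sum_(0 <= j < n) sigma j * e j c.2 * e j a.2).
    apply/funext => n.
    transitivity (\sum_(0 <= j < n) \sum_(a <- s) a.1 *
        \sum_(c <- s) c.1 * (sigma j * e j c.2 * e j a.2)).
      apply: eq_bigr => j _; rewrite expr2 {1}/V mulr_suml mulr_sumr; apply: eq_bigr => a _.
      rewrite /V !mulr_sumr; apply: eq_bigr => c _; ring.
    rewrite exchange_big; apply: eq_bigr => a _ /=; rewrite -mulr_sumr; congr (_ * _).
    by rewrite exchange_big; apply: eq_bigr => c _ /=; rewrite -mulr_sumr.
  apply: cvg_sumr => a; apply: cvgMr; apply: cvg_sumr => c; apply: cvgMr; exact: mercer.
rewrite -subr_ge0.
apply: (cvgn_ge (M := 0) (cvgB (cvgM c2 risk_cvg) (cvgM c1 c1))) => n _.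
have := weighted_cauchy_schwarz (index_iota 0 n) V d sigma_ge0.
by rewrite expr2 -subr_ge0.
Qed.

End Weights.

End Mercer.

(** * From the risk to the worst-case error over the unit ball *)

Section WorstCaseError.
Variables (R : realType) (dX : measure_display) (X : measurableType dX).
Variables (mu : probability X R) (k : X -> X -> R) (sigma : nat -> R) (e : nat -> X -> R).
Variables (b : R) (H : set (X -> R)) (ip : (X -> R) -> (X -> R) -> R).
Hypothesis rkhs : is_rkhs k H ip.
Hypotheses (e_on : orthonormal_L2 mu e) (sigma_ge0 : forall j, 0 <= sigma j).
Hypothesis mercer :
  forall x y, (fun n => \sum_(0 <= j < n) sigma j * e j x * e j y) @ \oo --> k x y.
Hypothesis k_le : forall x, k x x <= b.

Lemma kcomb_measurable s : measurable_fun setT (kcomb k s).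
Proof.
apply: measurable_sum => a; apply: measurable_funM => //.
have -> : k a.2 = k^~ a.2 by apply/funext => x; have [_ [_ [_ [_ [_ [_ [Hk ipk]]]]]]] := rkhs;
  rewrite -(ipk _ _ (Hk a.2)) -(ipk _ _ (Hk x)); have [_ [_ [ipC _]]] := rkhs; exact: ipC.
exact: (kernel_measurable e_on mercer a.2).
Qed.

(** Evaluation has norm at most [Num.sqrt b], so density in norm gives uniform density.
    Measurability and error bounds thereby pass from kernel combinations to all of [H]. *)
Lemma kcomb_approx f (delta : R) : H f -> 0 < delta ->
  exists2 s, ip (fun x => f x - kcomb k s x) (fun x => f x - kcomb k s x) < delta ^+ 2 &
    forall x, `|f x - kcomb k s x| <= delta * Num.sqrt b.
Proof.
move=> Hf d0; have d2 : 0 < delta ^+ 2 by rewrite exprn_gt0.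
have [s sd] := kcomb_dense rkhs Hf d2; exists s => // x.
have Hs := kcomb_rkhs rkhs s; have Hg := rkhs_sub rkhs Hf Hs.
have b0 : 0 <= b.
  by apply: le_trans (k_le x); have [_ [_ [_ [_ [P [_ [Hk ipk]]]]]]] := rkhs;
     rewrite -(ipk _ x (Hk x)); case: (P _ (Hk x)).
have dsb : 0 <= delta * Num.sqrt b by rewrite mulr_ge0 ?sqrtr_ge0 // ltW.
rewrite -(ler_pXn2r (ltn0Sn 1)) ?nnegrE // real_normK ?num_real // exprMn sqr_sqrtr //.
apply: le_trans (rkhs_eval_le rkhs x Hg) _.
apply: ler_pM => //; last exact: ltW.
- by have [_ [_ [_ [_ [P _]]]]] := rkhs; case: (P _ Hg).
- by have [_ [_ [_ [_ [P [_ [Hk ipk]]]]]]] := rkhs;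
     rewrite -(ipk _ x (Hk x)); case: (P _ (Hk x)).
Qed.

Lemma rkhs_measurable f : H f -> measurable_fun setT f.
Proof.
move=> Hf; have pos n : 0 < n.+1%:R^-1 :> R by rewrite invr_gt0.
have [s sP] := choice (fun n => let: ex_intro2 s _ h := kcomb_approx Hf (pos n) in
  ex_intro (fun s => forall x, `|f x - kcomb k s x| <= n.+1%:R^-1 * Num.sqrt b) s h).
apply: (measurable_fun_cvg (h := fun n => kcomb k (s n))) => [n|x _].
  exact: kcomb_measurable.
apply/cvgrPdist_le => eps eps0.
have b1 : 0 < Num.sqrt b + 1 by rewrite ltr_wpDl ?sqrtr_ge0.
have [M Me] := exists_invS_lt (divr_gt0 eps0 b1).
exists M => // n Mn; apply: le_trans (sP n x) _.
apply: (@le_trans _ _ (M.+1%:R^-1 * (Num.sqrt b + 1))).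
  apply: ler_pM; rewrite ?invr_ge0 ?sqrtr_ge0 ?lerDl //.
  by rewrite lef_pV2 ?posrE ?ltr0n // ler_nat ltnS.
by rewrite -ler_pdivlMr // ltW.
Qed.

Variables (N : nat) (xs : 'I_N -> X) (w : 'I_N -> R).
Hypothesis w_simplex : simplex w.
Let rho := risk (embed_sq mu sigma e) k xs (fun i => kme mu k (xs i)) w.

Lemma kcomb_quadrature_error s :
  `|\int[mu]_x kcomb k s x - \sum_i w i * kcomb k s (xs i)| <=
  Num.sqrt (ip (kcomb k s) (kcomb k s)) * Num.sqrt rho.
Proof.
have Hs := kcomb_rkhs rkhs s.
have rho0 : 0 <= rho by exact: (risk_ge0 e_on sigma_ge0 mercer k_le).
have ip0 : 0 <= ip (kcomb k s) (kcomb k s).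
  by have [_ [_ [_ [_ [P _]]]]] := rkhs; case: (P _ Hs).
have kC x y : k x y = k y x.
  by have [_ [_ [ipC [_ [_ [_ [Hk ipk]]]]]]] := rkhs; rewrite -(ipk _ y (Hk x)) -(ipk _ x (Hk y)) ipC.
have ki a : mu.-integrable setT (EFin \o k^~ a).
  apply: (@bounded_integrable _ _ _ mu _ b); first exact: (kernel_measurable e_on mercer a).
  by move=> x; exact: (kernel_abs_le sigma_ge0 mercer k_le).
have -> : \int[mu]_x kcomb k s x - \sum_i w i * kcomb k s (xs i) =
    \sum_(a <- s) a.1 * (kme mu k a.2 - \sum_i w i * k (xs i) a.2).
  rewrite /kcomb Rintegral_sumr => [|a].
    under [X in _ - X]eq_bigr do rewrite mulr_sumr.
    rewrite [X in _ - X]exchange_big -sumrB; apply: eq_bigr => a _ /=.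
    under eq_Rintegral do rewrite kC; rewrite RintegralZl // mulrBr; congr (_ - _).
    by rewrite mulr_sumr; apply: eq_bigr => i _; rewrite mulrCA kC.
  have -> : k a.2 = k^~ a.2 by apply/funext => x; exact: kC.
  exact: integrable_scale.
rewrite -sqrtrM // -[leLHS]sqrtr_sqr ler_wsqrtr // (ip_kcomb rkhs) //.
exact: (kcomb_quadrature_sq e_on sigma_ge0 mercer k_le).
Qed.

(** Write [f = v + g] with [v] a kernel combination of norm at most [1 + delta] and [g] uniformly
    small; only [v] needs the Cauchy-Schwarz bound. *)
Lemma rkhs_quadrature_error f : H f -> ip f f <= 1 ->
  `|\int[mu]_x f x - \sum_i w i * f (xs i)| <= Num.sqrt rho.
Proof.
move=> Hf f1; apply/ler_addgt0Pr => eps eps0.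
(* The total loss is [delta * (Num.sqrt rho + 2 * Num.sqrt b)]; the summand 1 makes [c] positive. *)
pose c := Num.sqrt rho + 2 * Num.sqrt b + 1.
have c0 : 0 < c by rewrite /c; have := sqrtr_ge0 rho; have := sqrtr_ge0 b; lra.
pose delta := eps / c; have d0 : 0 < delta by rewrite divr_gt0.
have [s sd fs] := kcomb_approx Hf d0.
pose v := kcomb k s; have Hv : H v by exact: (kcomb_rkhs rkhs s).
pose g x := f x - v x; have Hg : H g by exact: (rkhs_sub rkhs Hf Hv).
have mv : measurable_fun setT v by exact: kcomb_measurable.
have mf := rkhs_measurable Hf.
have mg : measurable_fun setT g by exact: measurable_funB.
have gi : mu.-integrable setT (EFin \o g) by exact: (bounded_integrable mu mg fs).
have vi : mu.-integrable setT (EFin \o v).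
  apply: (@bounded_integrable _ _ _ mu _ (Num.sqrt (ip v v) * Num.sqrt b) mv) => x.
  have b0 := kernel_abs_le sigma_ge0 mercer k_le x x.
  have ip0 : 0 <= ip v v by have [_ [_ [_ [_ [P _]]]]] := rkhs; case: (P _ Hv).
  rewrite -sqrtrM // -[leLHS]sqrtr_sqr ler_wsqrtr //.
  by apply: le_trans (rkhs_eval_le rkhs x Hv) _; rewrite ler_wpM2l.
have vn : Num.sqrt (ip v v) <= 1 + delta.
  have ip0 : 0 <= ip v v by have [_ [_ [_ [_ [P _]]]]] := rkhs; case: (P _ Hv).
  have vE : v = (fun x => f x - g x) by apply/funext => x; rewrite /g subKr.
  have d1 : 0 <= 1 + delta by rewrite addr_ge0 // ltW.
  rewrite -(ler_pXn2r (ltn0Sn 1)) ?nnegrE ?sqrtr_ge0 // sqr_sqrtr //.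
  rewrite {1 2}vE (rkhs_ip_sub rkhs Hf Hg).
  have : `|ip f g| <= delta.
    rewrite -(ler_pXn2r (ltn0Sn 1)) ?nnegrE ?(ltW d0) // real_normK ?num_real //.
    apply: le_trans (rkhs_cauchy_schwarz rkhs Hf Hg) _; rewrite -[leRHS]mul1r.
    have [_ [_ [_ [_ [P _]]]]] := rkhs.
    by apply: ler_pM; [case: (P _ Hf)|case: (P _ Hg)|exact: f1|exact: ltW].
  rewrite ler_norml => /andP[h _]; have := sd; rewrite -/v -/g.
  by move: h f1; move: (ip f g) (ip f f) (ip g g) => *; nra.
have fE : \int[mu]_x f x - \sum_i w i * f (xs i) =
   (\int[mu]_x v x - \sum_i w i * v (xs i)) + (\int[mu]_x g x - \sum_i w i * g (xs i)).
  have -> : \int[mu]_x f x = \int[mu]_x v x + \int[mu]_x g x.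
    by rewrite -RintegralD //; apply: eq_Rintegral => x _; rewrite /g subrKC.
  have -> : \sum_i w i * f (xs i) = \sum_i w i * v (xs i) + \sum_i w i * g (xs i).
    by rewrite -big_split; apply: eq_bigr => i _ /=; rewrite -mulrDr /g subrKC.
  ring.
have h1 := kcomb_quadrature_error s.
have h2 := Rintegral_abs_le mu mg fs.
have h3 : `|\sum_i w i * g (xs i)| <= delta * Num.sqrt b.
  case: w_simplex => w0 w1; rewrite -[leRHS]mul1r -w1 mulr_suml.
  apply: le_trans (ler_norm_sum _ _ _) _; apply: ler_sum => i _.
  by rewrite normrM ger0_norm //; apply: ler_wpM2l => //; exact: fs.
rewrite fE; apply: le_trans (ler_normD _ _) _.
apply: (@le_trans _ _ ((1 + delta) * Num.sqrt rho + (delta * Num.sqrt b + delta * Num.sqrt b))).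
  apply: lerD.
    by apply: le_trans h1 _; rewrite ler_wpM2r // sqrtr_ge0.
  by apply: le_trans (ler_normB _ _) _; apply: lerD.
have -> : eps = delta * c by rewrite /delta divfK // gt_eqF.
by rewrite /c; lra.
Qed.

Lemma wce_le : (wce mu H ip xs w <= (Num.sqrt rho)%:E)%E.
Proof.
apply: ge_ereal_sup => _ [f [Hf f1] <-].
have fb x : `|f x| <= Num.sqrt b.
  have b0 := kernel_abs_le sigma_ge0 mercer k_le x x.
  rewrite -[leLHS]sqrtr_sqr ler_wsqrtr //.
  apply: le_trans (rkhs_eval_le rkhs x Hf) _.
  have k0 : 0 <= k x x by have := mercer_partial_le sigma_ge0 mercer 0 x; rewrite big_geq.
  rewrite -[leRHS]mul1r; apply: ler_pM => //.
  by have [_ [_ [_ [_ [P _]]]]] := rkhs; case: (P _ Hf).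
have fi := bounded_integrable mu (rkhs_measurable Hf) fb.
have -> : (\int[mu]_x (f x)%:E)%E = (\int[mu]_x f x)%:E.
  by rewrite /Rintegral fineK //; exact: (integral_fune_fin_num _ fi).
by rewrite -EFinB /= lee_fin rkhs_quadrature_error.
Qed.

End WorstCaseError.

(** * Discretization of bounded vector-valued maps *)

Section FiniteRounding.
Variables (R : realType) (dT : measure_display) (T : measurableType dT).

(** The event is the finite disjoint union of the fibres over [Q]. *)
Lemma finite_valued_measure (P : probability T R) (S : finType) (c : T -> S) :
  (forall s, measurable (c @^-1` [set s])) -> forall Q : pred S,
  measurable [set t | Q (c t)] /\
  fine (P [set t | Q (c t)]) = \sum_(s | Q s) fine (P (c @^-1` [set s])).
Proof.
move=> mc Q.
pose F (i : 'I_#|S|) := c @^-1` [set enum_val i].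
have E : [set t | Q (c t)] = \big[setU/set0]_(i < #|S| | Q (enum_val i)) F i.
  rewrite -bigcup_seq_cond; apply/seteqP; split => t /=.
    move=> Qt; exists (enum_rank (c t)); rewrite /F /= ?enum_rankK // mem_index_enum.
    by rewrite Qt.
  by move=> [i /= /andP[_ Qi]]; rewrite /F /= => ->.
split; first by rewrite E; apply: bigsetU_measurable => i _; exact: mc.
rewrite E measure_bigsetU_ord_cond => [|i _|]; first last.
- by move=> i j _ _ [t [/= ti tj]]; apply: enum_val_inj; rewrite -ti -tj.
- exact: mc.
rewrite -sum_fine => [|i _]; last by apply: fin_num_measure; exact: mc.
rewrite [RHS](reindex (@enum_val S predT)) /=; first by [].
by apply: onW_bij; exact: enum_val_bij.
Qed.

Lemma finite_rounding D (psi : T -> 'I_D -> R) (kap delta : R) :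
  (forall j, measurable_fun setT (psi^~ j)) -> (forall x j, `|psi x j| <= kap) -> 0 < delta ->
  exists (F : finType) (cell : T -> F) (rep : F -> 'I_D -> R),
    (forall v, measurable (cell @^-1` [set v])) /\
    forall x, dot (fun j => psi x j - rep (cell x) j) (fun j => psi x j - rep (cell x) j)
      <= delta ^+ 2.
Proof.
move=> mpsi psib d0.
(* Each of the [D] coordinates has error at most [eta], and [D <= (D + 1) ^ 2]. Adding [kap] below
   makes the coordinates nonnegative, as truncation requires. *)
pose eta := delta / D.+1%:R; have eta0 : 0 < eta by rewrite divr_gt0.
pose y x j := (psi x j + kap) / eta.
have y0 x j : 0 <= y x j.
  by rewrite divr_ge0 ?(ltW eta0) //; have := psib x j; rewrite ler_norml; lra.
pose L := Num.truncn (2 * kap / eta).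
have yL x j : (Num.truncn (y x j) < L.+1)%N.
  rewrite ltnS; apply: le_truncn; rewrite ler_wpM2r ?invr_ge0 ?(ltW eta0) //.
  by have := psib x j; rewrite ler_norml; lra.
pose cell x : {ffun 'I_D -> 'I_L.+1} := [ffun j => Ordinal (yL x j)].
pose rep (v : {ffun 'I_D -> 'I_L.+1}) j : R := (v j : nat)%:R * eta - kap.
exists ({ffun 'I_D -> 'I_L.+1} : finType); exists cell, rep; split.
  move=> v; have -> : cell @^-1` [set v] =
      \bigcap_(j in [set: 'I_D]) ((y^~ j) @^-1` `[(v j : nat)%:R, (v j).+1%:R[).
    apply/seteqP; split => x /=.
      move=> <- j _ /=; rewrite in_itv /= ffunE /=; exact: truncn_itv.
    move=> h; apply/ffunP => j; apply: val_inj; rewrite ffunE /=.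
    by apply: truncn_def; have := h j I; rewrite /= in_itv.
  apply: fin_bigcap_measurable => // j _; rewrite -[X in measurable X]setTI.
  have my : measurable_fun setT (y^~ j).
    by apply: measurable_funM => //; exact: measurable_funD.
  by apply: my => //; exact: measurable_itv.
move=> x; apply: (@le_trans _ _ (\sum_(j < D) eta ^+ 2)).
  apply: ler_sum => j _; rewrite -expr2 /rep ffunE /=.
  have -> : psi x j = y x j * eta - kap by rewrite /y divfK ?gt_eqF // addrK.
  have /andP[h1 h2] := truncn_itv (y0 x j); move: h2; rewrite -natr1 => h2.
  set a : R := (Num.truncn (y x j))%:R in h1 h2 *; set z := y x j in h1 h2 *.
  have -> : z * eta - kap - (a * eta - kap) = (z - a) * eta by ring.
  by rewrite exprMn ler_piMl ?sqr_ge0 // expr_le1 //; lra.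
rewrite sumr_const card_ord -mulr_natr /eta expr_div_n -mulrA ler_piMr ?sqr_ge0 //.
rewrite mulrC ler_pdivrMr ?exprn_gt0 // mul1r -natrX ler_nat.
by rewrite (leq_trans (leqnSn D)) // -mulnn leq_pmulr.
Qed.

End FiniteRounding.

(** * The [dd + 1] Mercer features and their relation to the risk *)

Section Features.
Variables (R : realType) (dX : measure_display) (X : measurableType dX).
Variables (mu : probability X R) (k : X -> X -> R) (sigma : nat -> R) (e : nat -> X -> R).
Variables (kap : R) (dd : nat).
Hypothesis kap_ge0 : 0 <= kap.
Hypotheses (e_on : orthonormal_L2 mu e) (sigma_ge0 : forall j, 0 <= sigma j).
Hypothesis mercer :
  forall x y, (fun n => \sum_(0 <= j < n) sigma j * e j x * e j y) @ \oo --> k x y.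
Hypothesis k_le : forall x, k x x <= kap ^+ 2.

(** The norm of the component of [k x] beyond the first [dd] Mercer modes. *)
Definition resid x : R := Num.sqrt (k x x - \sum_(0 <= j < dd) sigma j * e j x ^+ 2).

Definition feat x (j : 'I_dd.+1) : R :=
  if (j < dd)%N then Num.sqrt (sigma j) * e j x else resid x.

Definition fmean (j : 'I_dd.+1) : R := \int[mu]_x feat x j.

(** Indices start at 0 here, so [j >= dd] matches [j > d] in one-based numbering. *)
Definition sigma_tail : R := limn (fun n => \sum_(dd <= j < n) sigma j).

Lemma resid_sq x : resid x ^+ 2 = k x x - \sum_(0 <= j < dd) sigma j * e j x ^+ 2.
Proof. by rewrite sqr_sqrtr // subr_ge0; exact: (mercer_partial_le sigma_ge0 mercer). Qed.

Lemma feat_last x : feat x ord_max = resid x.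
Proof. by rewrite /feat ltnn. Qed.

Lemma sum_feat (f : 'I_dd.+1 -> R) (g : nat -> R) :
  (forall j : 'I_dd.+1, (j < dd)%N -> f j = g j) ->
  \sum_j f j = \sum_(0 <= j < dd) g j + f ord_max.
Proof.
move=> fg; rewrite big_ord_recr big_mkord /=; congr (_ + _).
by apply: eq_bigr => j _; exact: (fg (widen_ord (leqnSn dd) j) (ltn_ord j)).
Qed.

Lemma feat_dot x : dot (feat x) (feat x) = k x x.
Proof.
rewrite /dot (sum_feat (g := fun j => sigma j * e j x ^+ 2)) => [|j jd].
  by rewrite feat_last -expr2 resid_sq subrKC.
by rewrite /feat jd -expr2 exprMn sqr_sqrtr.
Qed.

Lemma feat_abs_le x j : `|feat x j| <= kap.
Proof.
rewrite -(ler_pXn2r (ltn0Sn 1)) ?nnegrE // real_normK ?num_real //.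
apply: le_trans (k_le x); rewrite -feat_dot /dot (bigD1 j) //= -expr2 lerDl.
by apply: sumr_ge0 => i _; rewrite -expr2 sqr_ge0.
Qed.

Lemma feat_measurable j : measurable_fun setT (feat^~ j).
Proof.
have [jd|jd] := boolP (j < dd)%N.
  have -> : feat^~ j = (fun x => Num.sqrt (sigma j) * e j x).
    by apply/funext => x; rewrite /feat jd.
  by apply: measurable_funM => //; exact: (e_measurable e_on).
have -> : feat^~ j = resid by apply/funext => x; rewrite /feat (negPf jd).
apply: measurableT_comp; first exact: (continuous_measurable_fun (@sqrt_continuous R)).
apply: measurable_funB; first exact: (kernel_diag_measurable e_on mercer).
apply: measurable_sum => i; apply: measurable_funM => //.
exact/measurable_funX/(e_measurable e_on).
Qed.

Lemma feat_integrable j : mu.-integrable setT (EFin \o feat^~ j).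
Proof. exact: (bounded_integrable mu (feat_measurable j) (feat_abs_le^~ j)). Qed.

Lemma fmean_lt (j : 'I_dd.+1) : (j < dd)%N -> fmean j = Num.sqrt (sigma j) * emean mu e j.
Proof.
move=> jd; rewrite /fmean; under eq_Rintegral do rewrite /feat jd.
by rewrite RintegralZl //; exact: (e_integrable e_on).
Qed.

Lemma sigma_tailE : sigma_tail = \int[mu]_x k x x - \sum_(0 <= j < dd) sigma j.
Proof.
apply: cvg_lim => //.
have : (fun n => \sum_(0 <= j < n) sigma j - \sum_(0 <= j < dd) sigma j) @ \oo -->
    \int[mu]_x k x x - \sum_(0 <= j < dd) sigma j.
  by apply: cvgB; [exact: (kernel_trace e_on sigma_ge0 mercer k_le)|exact: cvg_cst].
apply: cvg_trans; apply: near_eq_cvg; exists dd => // n /= dn.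
by rewrite (big_cat_nat (leq0n dd) dn) /= addrAC subrr add0r.
Qed.

Lemma sum_sigma_tail_le n : \sum_(dd <= j < n) sigma j <= sigma_tail.
Proof.
have [dn|/ltnW nd] := leqP dd n.
  rewrite sigma_tailE lerBrDr addrC -(big_cat_nat (leq0n dd) dn).
  exact: (sum_sigma_le_trace e_on sigma_ge0 mercer k_le).
rewrite big_geq // sigma_tailE subr_ge0.
exact: (sum_sigma_le_trace e_on sigma_ge0 mercer k_le).
Qed.

Lemma sigma_tail_ge0 : 0 <= sigma_tail.
Proof. by apply: le_trans (sum_sigma_tail_le 0); rewrite big_geq. Qed.

Lemma resid_sq_integral : \int[mu]_x (resid x ^+ 2) = sigma_tail.
Proof.
under eq_Rintegral do rewrite resid_sq.
have si j : mu.-integrable setT (EFin \o (fun x => sigma j * e j x ^+ 2)).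
  exact/integrable_scale/(e_sq_integrable e_on).
rewrite RintegralB //; last 2 first.
- exact: (kernel_diag_integrable e_on sigma_ge0 mercer k_le).
- exact: integrable_sumr.
rewrite sigma_tailE Rintegral_sumr //; congr (_ - _); apply: eq_bigr => j _.
by rewrite RintegralZl ?(e_sq_integral e_on) ?mulr1 //; exact: (e_sq_integrable e_on).
Qed.

(** The mean residual is at most the root of its second moment, which is the tail trace. *)
Lemma fmean_last_le : fmean ord_max <= Num.sqrt sigma_tail.
Proof.
apply: le_trans (ler_norm _) _; rewrite -sqrtr_sqr ler_wsqrtr // -resid_sq_integral.
have E : feat^~ ord_max = resid by apply/funext => x; exact: feat_last.
have ri : mu.-integrable setT (EFin \o resid) by rewrite -E; exact: feat_integrable.
rewrite /fmean E; apply: Rintegral_sq_le => //.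
have mr : measurable_fun setT resid by rewrite -E; exact: feat_measurable.
have m2 : measurable_fun setT (fun x => resid x ^+ 2) by exact: measurable_funX.
have rb x : `|resid x ^+ 2| <= kap ^+ 2.
  rewrite -feat_last normrX; have := feat_abs_le x ord_max.
  by rewrite -(ler_pXn2r (ltn0Sn 1)) ?nnegrE.
exact: (bounded_integrable mu m2 rb).
Qed.

Lemma dot_fmean c : dot c fmean = \int[mu]_x dot c (feat x).
Proof.
rewrite /dot Rintegral_sumr => [|j]; last exact/integrable_scale/feat_integrable.
by apply: eq_bigr => j _; rewrite RintegralZl //; exact: feat_integrable.
Qed.

Lemma dot_feat_abs_le c x : `|dot c (feat x)| <= Num.sqrt (dot c c) * kap.
Proof.
rewrite -[X in _ * X](ger0_norm kap_ge0) -[in leRHS]sqrtr_sqr -sqrtrM ?dot_ge0 //.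
rewrite -[leLHS]sqrtr_sqr ler_wsqrtr //.
apply: le_trans (dot_cauchy_schwarz _ _) _.
by rewrite ler_wpM2l ?dot_ge0 // feat_dot.
Qed.

Lemma dot_feat_measurable c : measurable_fun setT (fun x => dot c (feat x)).
Proof. by apply: measurable_sum => j; apply: measurable_funM => //; exact: feat_measurable. Qed.

Lemma halfspace_measurable c (a : R) :
  measurable [set x | a < dot c (feat x) - dot c fmean].
Proof.
have -> : [set x | a < dot c (feat x) - dot c fmean] =
   setT `&` (fun x => dot c (feat x) - dot c fmean) @^-1` `]a, +oo[.
  by rewrite setTI; apply/seteqP; split => x /=; rewrite in_itv /= andbT.
have m1 : measurable_fun setT (fun x => dot c (feat x) - dot c fmean).
  by apply: measurable_funB => //; exact: dot_feat_measurable.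
by apply: m1 => //; exact: measurable_itv.
Qed.

(* Markov's inequality for the nonnegative variable [dot c (feat x - fmean) + 2 kap |c|]. *)
Lemma halfspace_le c n : (0 < n)%N -> 0 < kap -> 0 < dot c c ->
  fine (mu [set x | 2 * kap / n%:R * Num.sqrt (dot c c) < dot c (feat x) - dot c fmean])
    <= n%:R / n.+1%:R.
Proof.
move=> n0 kap0 c0; set nc := Num.sqrt (dot c c).
have nc0 : 0 < nc by rewrite sqrtr_gt0.
have nR : 0 < n%:R :> R by rewrite ltr0n.
pose g x := dot c (feat x) + (2 * kap * nc - dot c fmean).
have mc : `|dot c fmean| <= nc * kap.
  rewrite dot_fmean; apply: Rintegral_abs_le; first exact: dot_feat_measurable.
  exact: dot_feat_abs_le.
have g0 x : 0 <= g x.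
  have := dot_feat_abs_le c x; rewrite -/nc; move: mc; rewrite !ler_norml /g; lra.
have mg : measurable_fun setT g by apply: measurable_funD => //; exact: dot_feat_measurable.
have gI : \int[mu]_x g x = 2 * kap * nc.
  rewrite RintegralD ?Rintegral_cstT //.
  - by rewrite -dot_fmean; ring.
  - exact: (bounded_integrable mu (dot_feat_measurable c) (dot_feat_abs_le c)).
  - exact: (finite_measure_integrable_cst _ _ measurableT).
(* The level is [2 * kap * nc] plus the half-space offset [2 * kap / n * nc]; since [g] has mean
   [2 * kap * nc], the ratio is exactly [n / (n + 1)]. *)
pose a := 2 * kap * nc * (n.+1%:R / n%:R).
have a0 : 0 < a by rewrite !mulr_gt0 ?invr_gt0 // ltr0n.
have gi : mu.-integrable setT (EFin \o g).
  apply: (@bounded_integrable _ _ _ mu _ (4 * kap * nc)) => // x.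
  rewrite ger0_norm //; have := dot_feat_abs_le c x; rewrite -/nc.
  by move: mc; rewrite !ler_norml /g; lra.
have := @le_integral_abse _ _ _ mu setT measurableT (EFin \o g) a _ a0.
have -> : (\int[mu]_x `|(EFin \o g) x|)%E = (\int[mu]_x g x)%:E.
  rewrite /Rintegral fineK; last exact: (integral_fune_fin_num _ gi).
  by apply: eq_integral => x _ /=; rewrite ger0_norm.
rewrite gI => /(_ (proj2 (measurable_EFinP _ _) mg)); rewrite setTI => h.
pose A := [set x | (a%:E <= `|(EFin \o g) x|)%E].
have mA : measurable A.
  have -> : A = g @^-1` `[a, +oo[.
    by apply/seteqP; split => x; rewrite /A /= in_itv /= andbT lee_fin ger0_norm.
  by rewrite -[X in measurable X]setTI; apply: mg => //; exact: measurable_itv.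
have {}h : a * fine (mu A) <= 2 * kap * nc.
  by move: h; rewrite -/A -[X in (_ * X)%E]fineK ?fin_num_measure // -EFinM lee_fin.
have mS := halfspace_measurable c (2 * kap / n%:R * nc).
apply: (@le_trans _ _ (fine (mu A))).
  apply: fine_le; rewrite ?fin_num_measure // le_measure ?inE // => x /= hx.
  rewrite /A /= lee_fin ger0_norm // /a /g.
  have -> : 2 * kap * nc * (n.+1%:R / n%:R) = 2 * kap * nc + 2 * kap / n%:R * nc.
    by rewrite -[n.+1%:R]natr1; field; rewrite gt_eqF.
  by lra.
have kn : 0 < 2 * kap * nc by rewrite !mulr_gt0.
move: h; rewrite /a -mulrA -[leRHS]mulr1 ler_pM2l // => h.
rewrite -(ler_pM2l (_ : 0 < n.+1%:R / n%:R)) ?divr_gt0 ?ltr0n //.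
by rewrite (le_trans h) // mulrA divfK ?gt_eqF // divff // gt_eqF.
Qed.

(** The head modes contribute [A], part of [dot u u]. The tail modes contribute at most
    [(t + z) ^+ 2], where the average residual [z] is at most [t] plus the last coordinate error.
    Since [A] plus the square of that error is at most [beta ^+ 2], the sum fits the bound. *)
Lemma risk_le_feature N (xs : 'I_N -> X) (w : 'I_N -> R) (beta : R) : simplex w -> 0 <= beta ->
  dot (fun j => comb w (feat \o xs) j - fmean j) (fun j => comb w (feat \o xs) j - fmean j)
    <= beta ^+ 2 ->
  risk (embed_sq mu sigma e) k xs (fun i => kme mu k (xs i)) w <=
    (2 * Num.sqrt sigma_tail + beta) ^+ 2.
Proof.
move=> ws beta0 ub; case: (ws) => w0 w1.
set t := Num.sqrt sigma_tail; set u := fun j => comb w (feat \o xs) j - fmean j in ub.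
pose z := \sum_i w i * resid (xs i).
have t0 : 0 <= t by exact: sqrtr_ge0.
have z0 : 0 <= z by apply: sumr_ge0 => i _; rewrite mulr_ge0 // sqrtr_ge0.
have zu : z = u ord_max + fmean ord_max.
  by rewrite /u subrK; apply: eq_bigr => i _ /=; rewrite feat_last.
have uE : dot u u = \sum_(0 <= j < dd) sigma j * (emean mu e j - \sum_i w i * e j (xs i)) ^+ 2
    + u ord_max ^+ 2.
  rewrite /dot (sum_feat (g := fun j =>
    sigma j * (emean mu e j - \sum_i w i * e j (xs i)) ^+ 2)) ?expr2 // => j jd.
  have -> : u j = Num.sqrt (sigma j) * (\sum_i w i * e j (xs i) - emean mu e j).
    rewrite /u fmean_lt // mulrBr mulr_sumr; congr (_ - _); apply: eq_bigr => i _ /=.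
    by rewrite /feat jd mulrCA.
  rewrite -expr2 exprMn sqr_sqrtr //; ring.
apply: (cvgn_le (M := dd) (@risk_cvg _ _ _ _ _ _ _ _ e_on sigma_ge0 mercer k_le _ _ _)) => n dn.
rewrite (big_cat_nat (leq0n dd) dn) /= (weighted_sq_expand _ _ _ _ _ (index_iota dd n)).
set A := \sum_(0 <= j < dd) _ in uE *.
have S1 : \sum_(dd <= j < n) sigma j * emean mu e j ^+ 2 <= t ^+ 2.
  rewrite sqr_sqrtr ?sigma_tail_ge0 //.
  exact: le_trans (sum_emean_le e_on sigma_ge0 _) (sum_sigma_tail_le n).
have S2 x : \sum_(dd <= j < n) sigma j * e j x ^+ 2 <= resid x ^+ 2.
  rewrite resid_sq lerBrDr addrC -(big_cat_nat (leq0n dd) dn).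
  exact: (mercer_partial_le sigma_ge0 mercer).
have cs (p q : R) (f g : nat -> R) : 0 <= p -> 0 <= q ->
    \sum_(dd <= j < n) sigma j * f j ^+ 2 <= p ^+ 2 ->
    \sum_(dd <= j < n) sigma j * g j ^+ 2 <= q ^+ 2 ->
    `|\sum_(dd <= j < n) sigma j * f j * g j| <= p * q.
  move=> p0 q0 fp gq.
  rewrite -(ler_pXn2r (ltn0Sn 1)) ?nnegrE ?mulr_ge0 // real_normK ?num_real //.
  apply: le_trans (weighted_cauchy_schwarz _ _ _ sigma_ge0) _; rewrite exprMn.
  by apply: ler_pM => //; apply: sumr_ge0 => j _; rewrite mulr_ge0 // sqr_ge0.
have L2 : - (t * z) <= \sum_i w i * \sum_(dd <= j < n) sigma j * emean mu e j * e j (xs i).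
  rewrite /z mulr_sumr -sumrN; apply: ler_sum => i _; rewrite mulrCA -mulrN ler_wpM2l //.
  have := cs t (resid (xs i)) (emean mu e) (e^~ (xs i)) t0 (sqrtr_ge0 _) S1 (S2 _).
  by rewrite ler_norml => /andP[].
have L3 : qform (fun i l => \sum_(dd <= j < n) sigma j * e j (xs i) * e j (xs l)) w w <= z ^+ 2.
  rewrite /qform expr2 /z mulr_suml; apply: ler_sum => i _; rewrite mulr_sumr.
  apply: ler_sum => l _; rewrite mulrACA ler_wpM2l ?mulr_ge0 //.
  have := cs _ _ (e^~ (xs i)) (e^~ (xs l)) (sqrtr_ge0 _) (sqrtr_ge0 _) (S2 _) (S2 _).
  by rewrite ler_norml => /andP[].
have m_le := fmean_last_le; rewrite -/t in m_le.
have ub' : `|u ord_max| <= beta.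
  rewrite -(ler_pXn2r (ltn0Sn 1)) ?nnegrE // real_normK ?num_real //.
  apply: le_trans ub; rewrite uE lerDr; apply: sumr_ge0 => j _.
  by rewrite mulr_ge0 // sqr_ge0.
have h1 : (t + z) ^+ 2 <= (2 * t + `|u ord_max|) ^+ 2.
  rewrite ler_pXn2r ?nnegrE ?addr_ge0 ?mulr_ge0 //.
  by rewrite zu; have := ler_norm (u ord_max); lra.
have h2 : t * `|u ord_max| <= t * beta by rewrite ler_wpM2l.
have h3 : `|u ord_max| ^+ 2 = u ord_max ^+ 2 by rewrite real_normK ?num_real.
move: L2 L3 S1 ub h1 h2 h3; rewrite uE.
move: (qform _ _ _) (\sum_(i < N) w i * _) (\sum_(dd <= j < n) _) => Q L S.
clearbody A; move: (`|u ord_max|) (u ord_max ^+ 2) => v v'; lra.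
Qed.

End Features.

(** * The high-probability event on which good convex weights exist *)

Section GoodSample.
Variables (R : realType) (dX : measure_display) (X : measurableType dX).
Variables (mu : probability X R) (k : X -> X -> R) (sigma : nat -> R) (e : nat -> X -> R).
Variables (kap : R) (dd : nat).
Hypotheses (e_on : orthonormal_L2 mu e) (sigma_ge0 : forall j, 0 <= sigma j).
Hypothesis mercer :
  forall x y, (fun n => \sum_(0 <= j < n) sigma j * e j x * e j y) @ \oo --> k x y.
Hypothesis k_le : forall x, k x x <= kap ^+ 2.
Variables (dO : measure_display) (Omega : measurableType dO) (P : probability Omega R).
Variables (N n : nat) (Xs : 'I_N -> Omega -> X).
Hypotheses (n_gt0 : (0 < n)%N) (Nn : (6 * dd.+1 * n <= N)%N) (iid : iid_with_law P mu Xs).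

Lemma exists_good_weights : 0 < kap ->
  exists E : set Omega, [/\ measurable E, ((1 - 2 ^- dd.+1)%:E <= P E)%E &
    forall om, E om -> exists2 w, simplex w &
      risk (embed_sq mu sigma e) k (Xs^~ om) (fun i => kme mu k (Xs i om)) w <=
        (2 * Num.sqrt (sigma_tail sigma dd) + 4 * kap / n%:R) ^+ 2].
Proof.
move=> kap0; have kap_ge0 := ltW kap0.
have nR : 0 < n%:R :> R by rewrite ltr0n.
pose psi := @feat R dX X k sigma e dd; pose theta := @fmean R dX X mu k sigma e dd.
pose delta := kap / n%:R; have delta0 : 0 < delta by rewrite divr_gt0.
have [F [cell [rep [mcell close]]]] :=
  finite_rounding (feat_measurable (dd := dd) e_on mercer)
    (feat_abs_le (dd := dd) kap_ge0 sigma_ge0 mercer k_le) delta0.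
pose p v : R := fine (mu (cell @^-1` [set v])).
have p_ge0 v : 0 <= p v by apply: fine_ge0; exact: measure_ge0.
have p_sum Q : \sum_(v | Q v) p v = fine (mu [set x | Q (cell x)]).
  by have [_ ->] := finite_valued_measure mu mcell Q.
have p_sum1 : \sum_v p v = 1.
  rewrite p_sum; have -> : [set x | predT (cell x)] = setT by apply/seteqP.
  by rewrite probability_setT.
pose y v j := rep v j - theta j.
(* Two units of [kap / n] come from Markov's inequality and one from rounding inside the half-space
   test; undoing the rounding of the hull point adds the fourth. *)
pose eps := 3 * kap / n%:R; have eps0 : 0 <= eps by rewrite divr_ge0 ?mulr_ge0 // ltW.
pose q : R := n%:R / n.+1%:R.
have q01 : 0 <= q <= 1.
  by rewrite divr_ge0 //= ler_pdivrMr ?ltr0n // mul1r ler_nat.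
have qn : q ^+ n <= 2^-1.
  have -> : q = (1 + n%:R^-1)^-1 by rewrite /q -[n.+1%:R]natr1; field; lra.
  rewrite exprVn lef_pV2 ?posrE ?exprn_gt0 ?addr_gt0 ?invr_gt0 //.
  apply: le_trans (bernoulli_ineq n (_ : 0 <= n%:R^-1)); last by rewrite invr_ge0 ltW.
  by rewrite mulfV ?gt_eqF.
have hq c : 0 < dot c c -> \sum_(v | eps * Num.sqrt (dot c c) < dot c (y v)) p v <= q.
  move=> c0; rewrite p_sum.
  apply: le_trans (halfspace_le kap_ge0 e_on sigma_ge0 mercer k_le n_gt0 kap0 c0).
  have [mS _] := finite_valued_measure mu mcell (fun v => eps * Num.sqrt (dot c c) < dot c (y v)).
  have mH := halfspace_measurable (dd := dd) e_on mercer c (2 * kap / n%:R * Num.sqrt (dot c c)).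
  apply: fine_le; rewrite ?fin_num_measure // le_measure ?inE // => x /= h.
  have r_le : dot c (fun j => rep (cell x) j - psi x j) <= Num.sqrt (dot c c) * delta.
    apply: dot_le; rewrite ?sqrtr_ge0 ?(ltW delta0) ?sqr_sqrtr ?dot_ge0 //.
    apply: le_trans (close x); rewrite le_eqVlt; apply/orP; left; apply/eqP.
    by apply: eq_bigr => j _; rewrite -!expr2 -sqrrN opprB.
  have dB (u v : 'I_dd.+1 -> R) : dot c (fun j => u j - v j) = dot c u - dot c v.
    by rewrite /dot -sumrB; apply: eq_bigr => j _; rewrite mulrBr.
  move: h r_le; rewrite /y !dB -/psi -/theta /eps /delta -!mulrA.
  rewrite (mulrC (Num.sqrt _)); lra.
(* The rounded sample takes finitely many values and, by independence, has the product weights [p];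
   the event is a union of its fibres. *)
pose c om : {ffun 'I_N -> F} := [ffun i => cell (Xs i om)].
have cE s : c @^-1` [set s] = [set om | forall i : 'I_N, (cell @^-1` [set s i]) (Xs i om)].
  apply/seteqP; split => om /=; first by move=> <- i; rewrite ffunE.
  by move=> h; apply/ffunP => i; rewrite ffunE.
have [mXs law] := iid.
have mc s : measurable (c @^-1` [set s]).
  have -> : c @^-1` [set s] =
      \bigcap_(i in [set: 'I_N]) (setT `&` Xs i @^-1` (cell @^-1` [set s i])).
    rewrite cE; apply/seteqP; split => om /=; first by move=> h i _; split.
    by move=> h i; case: (h i I).
  by apply: fin_bigcap_measurable => // i _; apply: mXs.
have Pc s : fine (P (c @^-1` [set s])) = \prod_i p (s i).
  rewrite cE (law (fun i => cell @^-1` [set s i])) //.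
  have -> : (\prod_(i < N) mu (cell @^-1` [set s i]))%E = (\prod_i p (s i))%:E.
    by rewrite -prodEFin; apply: eq_bigr => i _; rewrite fineK // fin_num_measure.
  by [].
pose Q (s : {ffun 'I_N -> F}) :=
  `[< exists2 w, simplex w & dot (comb w (y \o s)) (comb w (y \o s)) <= eps ^+ 2 >].
have [mE PE] := finite_valued_measure P mc Q.
have N0 : (0 < N)%N by apply: leq_trans Nn; rewrite !muln_gt0.
exists [set om | Q (c om)]; split=> //.
  rewrite -[X in (_ <= X)%E]fineK ?fin_num_measure // lee_fin PE.
  under eq_bigr do rewrite Pc.
  have := bad_sample_bound p_ge0 p_sum1 (ltn0Sn dd) N0 Nn eps0 q01 qn hq.
  have := prod_sample_sum p_sum1 N; rewrite (bigID Q) /= -/Q; lra.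
move=> om /asboolP[w ws hw]; exists w => //.
apply: (risk_le_feature kap_ge0 e_on sigma_ge0 mercer k_le ws).
  by rewrite divr_ge0 // mulr_ge0.
pose r i j := psi (Xs i om) j - rep (cell (Xs i om)) j.
have hr : dot (comb w r) (comb w r) <= delta ^+ 2.
  by apply: dot_comb_le (ltW delta0) ws _ => i; exact: close.
have -> : (fun j => comb w (psi \o Xs^~ om) j - theta j) =
    (fun j => comb w (y \o c om) j + 1 * comb w r j).
  apply/funext => j; rewrite mul1r /comb -big_split /=.
  have -> : theta j = \sum_i w i * theta j by rewrite -mulr_suml (proj2 ws) mul1r.
  by rewrite -sumrB; apply: eq_bigr => i _; rewrite /y /r /c ffunE; ring.
have hwr := dot_le eps0 (ltW delta0) hw hr.
rewrite dotDl !dotDr (dotC (comb w r)).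
have -> : 4 * kap / n%:R = eps + delta by rewrite /eps /delta; ring.
by rewrite sqrrD; lra.
Qed.

End GoodSample.

Theorem theorem8 (R : realType) (dX : measure_display) (X : measurableType dX)
  (mu : probability X R) (k : X -> X -> R)
  (H : set (X -> R)) (ip : (X -> R) -> (X -> R) -> R)
  (sigma : nat -> R) (e : nat -> X -> R)
  (dO : measure_display) (Omega : measurableType dO) (P : probability Omega R)
  (N dd T : nat) (Xs : 'I_N -> Omega -> X) :
  pd_kernel k ->
  is_rkhs k H ip ->
  has_ubound (range (fun x => Num.sqrt (k x x))) ->
  orthonormal_L2 mu e ->
  (forall j, sigma j.+1 <= sigma j) -> (forall j, 0 <= sigma j) ->
  (forall x y, (fun n => \sum_(0 <= j < n) sigma j * e j x * e j y) @ \oo --> k x y) ->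
  (0 < N)%N -> (0 < dd)%N -> (6 * dd.+1 <= N)%N ->
  iid_with_law P mu Xs ->
  exists E : set Omega, measurable E /\
    (P E >= (1 - 2 ^- dd.+1)%:E)%E /\
    forall om, E om ->
      let xs := fun i => Xs i om in
      let nd := (N %/ (6 * dd.+1))%N in
      forall W : nat -> 'I_N -> R,
        fw_run k xs (fun i => kme mu k (xs i)) W T ->
        (wce mu H ip xs (W T) <=
          (2 * Num.sqrt (limn (fun n => \sum_(dd <= j < n) sigma j))%R
           + 4 * kappa k / nd%:R
           + 4 * kappa k / Num.sqrt (T%:R + 2))%R%:E)%E.
Proof.
move=> k_pd rkhs k_bd e_on _ sigma_ge0 mercer N0 _ dN iid.
set n := (N %/ (6 * dd.+1))%N; set kap := kappa k.
have n0 : (0 < n)%N by rewrite divn_gt0 // muln_gt0.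
have Nn : (6 * dd.+1 * n <= N)%N by rewrite mulnC leq_trunc_div.
have k0 x : 0 <= k x x by have := mercer_partial_le sigma_ge0 mercer 0 x; rewrite big_geq.
have sk x : Num.sqrt (k x x) <= kap by apply: (ub_le_sup k_bd); exists x.
have kap0 : 0 <= kap.
  (* Over an empty [X] the supremum is that of the empty set, 0 by default. *)
  have [[x _]|nX] := pselect (exists x : X, True); first exact: le_trans (sqrtr_ge0 _) (sk x).
  rewrite /kap /kappa; have -> : range (fun x => Num.sqrt (k x x)) = set0.
    by apply/seteqP; split=> // r [x _ _]; apply: nX; exists x.
  by rewrite sup0.
have k_le x : k x x <= kap ^+ 2.
  by rewrite -[leLHS]sqr_sqrtr // ler_pXn2r ?nnegrE ?sqrtr_ge0.
pose t := Num.sqrt (sigma_tail sigma dd).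
have [E [mE PE goodE]] : exists E : set Omega, [/\ measurable E,
    ((1 - 2 ^- dd.+1)%:E <= P E)%E & forall om, E om -> exists2 w, simplex w &
      risk (embed_sq mu sigma e) k (Xs^~ om) (fun i => kme mu k (Xs i om)) w <=
        (2 * t + 4 * kap / n%:R) ^+ 2].
  (* If [kap = 0] the risk bound [4 * kap ^+ 2] vanishes, so any vertex serves on the whole
     space. *)
  have [kapE|kapN] := eqVneq kap 0; last first.
    by apply: exists_good_weights; rewrite // lt_def kapN.
  exists setT; split=> // [|om _].
    by rewrite probability_setT lee_fin gerBl invr_ge0 exprn_ge0.
  exists (fun j => (j == Ordinal N0)%:R); first exact: simplex_vertex.
  apply: le_trans (risk_le e_on sigma_ge0 mercer k_le _ (simplex_vertex _ _)) _.
  by rewrite {1}kapE expr0n mulr0 sqr_ge0.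
exists E; split=> //; split=> // om Eom xs nd W run.
have [w ws wr] := goodE om Eom.
have [|Ws Wr] := frank_wolfe_rate k_pd k_le ws run (C := embed_sq mu sigma e).
  (* A vertex has risk at most [4 * kap ^+ 2] and the competitor a nonnegative one, which gives the
     initial excess. *)
  move=> i; apply: le_trans (risk_le e_on sigma_ge0 mercer k_le _ (simplex_vertex _ _)) _.
  have := risk_ge0 e_on sigma_ge0 mercer k_le xs w.
  have := sqr_ge0 kap; lra.
apply: le_trans (wce_le rkhs e_on sigma_ge0 mercer k_le xs Ws) _; rewrite lee_fin.
rewrite -/(sigma_tail sigma dd) -/t.
have t0 : 0 <= t by exact: sqrtr_ge0.
have T2 : 0 < T%:R + 2 :> R by rewrite ltr_wpDl.
set B := 4 * kap / Num.sqrt (T%:R + 2).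
have B0 : 0 <= B by rewrite divr_ge0 ?sqrtr_ge0 // mulr_ge0.
have A0 : 0 <= 2 * t + 4 * kap / n%:R by rewrite addr_ge0 ?divr_ge0 ?mulr_ge0.
rewrite -(ger0_norm (addr_ge0 A0 B0)) -sqrtr_sqr ler_wsqrtr //.
(* The Frank-Wolfe excess is the square of [B], so the risk is at most a sum of two squares, hence
   at most the square of the sum. *)
have B2 : 16 * kap ^+ 2 / (T%:R + 2) = B ^+ 2.
  rewrite /B expr_div_n sqr_sqrtr ?(ltW T2) // exprMn; congr (_ * _ / _); ring.
rewrite B2 in Wr; apply: le_trans Wr _; apply: le_trans (lerD wr (lexx _)) _.
by rewrite [leRHS]sqrrD lerD2r lerDl mulrn_wge0 // mulr_ge0.
Qed.
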